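(* In each of the following cases, $\{c_t^{(m)}(n)\}_{n\geq 0}$ is a UPS sequence whose least period of sign is divisible by $t$: (1) $t=2$ and $m$ is any positive integer; (2) $t=p$ is a prime and $m=1$ or $m=3$.
   Context: For positive integers $t,m$, the integers $c_t^{(m)}(n)$ are defined by $\sum_{n\ge 0}c_t^{(m)}(n)q^n=\frac{(q;q)_\infty^m}{(q^t;q^t)_\infty^m}$, where $(a;q)_\infty=\prod_{n=0}^\infty(1-aq^n)$, $|q|<1$. For real $x$, $\mathrm{sgn}(x)$ is $1$, $0$, $-1$ according as $x>0$, $x=0$, $x<0$. A sequence $\{a(n)\}_{n\ge0}$ of real numbers is a UPS sequence (ultimately periodic in sign) if there is a positive integer $T$ such that $\mathrm{sgn}(a(n))=\mathrm{sgn}(a(n+T))$ for all sufficiently large $n$; such a $T$ is called a period of sign, and the smallest such $T$ is called the least period of sign. *)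

(* Defs.v *)
From mathcomp Require Import all_boot all_order all_algebra.
Set Implicit Arguments.
Unset Strict Implicit.
Unset Printing Implicit Defensive.
Import Order.TTheory GRing.Theory Num.Theory.
Local Open Scope ring_scope.

(* Formal power series over the integers, as coefficient sequences: [f n] is
   the coefficient of q^n. *)
Definition fps := nat -> int.

Definition fps_one : fps := fun n => (n == 0)%:R.

Definition fps_mul (f g : fps) : fps :=
  fun n => \sum_(i < n.+1) f i * g (n - i)%N.

Definition fps_exp (f : fps) (m : nat) : fps := iter m (fps_mul f) fps_one.

(* Long division by a series [g] with constant coefficient 1: the list of the
   first [n] coefficients of [f / g]. The identity (f / g) * g = f and its
   uniqueness are [fps_divK] and [fps_div_uniq] below. *)
Fixpoint fps_div_seq (f g : fps) (n : nat) : seq int :=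
  if n is k.+1 then
    let s := fps_div_seq f g k in
    rcons s (f k - \sum_(i < k) s`_i * g (k - i)%N)
  else [::].

Definition fps_div (f g : fps) : fps := fun n => (fps_div_seq f g n.+1)`_n.

(* (a; x)_oo = \prod_(k >= 0) (1 - a x^k) for polynomials a, x in q without
   constant term. The factors with k > n are congruent to 1 modulo q^(n+1), so
   the coefficient of q^n is already that of the product over k <= n; see
   [qpochE]. *)
Definition qpoch (a x : {poly int}) : fps :=
  fun n => (\prod_(0 <= k < n.+1) (1 - a * x ^+ k))`_n.

(* c_t^(m)(n), the coefficient of q^n in (q; q)_oo^m / (q^t; q^t)_oo^m. *)
Definition cseq (t m : nat) : fps :=
  fps_div (fps_exp (qpoch 'X 'X) m) (fps_exp (qpoch 'X^t 'X^t) m).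

Definition period_of_sign (R : realDomainType) (a : nat -> R) (T : nat) : Prop :=
  (0 < T)%N /\
  exists N : nat, forall n : nat, (N <= n)%N -> Num.sg (a n) = Num.sg (a (n + T)%N).

Definition UPS (R : realDomainType) (a : nat -> R) : Prop :=
  exists T : nat, period_of_sign a T.

Definition least_period_of_sign (R : realDomainType) (a : nat -> R) (T : nat) :
    Prop :=
  period_of_sign a T /\ forall T' : nat, period_of_sign a T' -> (T <= T')%N.

Lemma size_fps_div_seq f g n : size (fps_div_seq f g n) = n.
Proof. by elim: n => //= n IHn; rewrite size_rcons IHn. Qed.

Lemma nth_fps_div_seq f g n i :
  (i < n)%N -> (fps_div_seq f g n)`_i = fps_div f g i.
Proof.
elim: n => // n IHn; rewrite ltnS leq_eqVlt => /orP[/eqP -> //|lt_in].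
by rewrite /= nth_rcons size_fps_div_seq lt_in IHn.
Qed.

Lemma fps_divE f g n :
  fps_div f g n = f n - \sum_(i < n) fps_div f g i * g (n - i)%N.
Proof.
rewrite {1}/fps_div /= nth_rcons size_fps_div_seq ltnn eqxx.
by congr (_ - _); apply: eq_bigr => i _; rewrite nth_fps_div_seq.
Qed.

Lemma fps_divK f g : g 0 = 1 -> fps_mul (fps_div f g) g =1 f.
Proof.
move=> g0 n; rewrite /fps_mul big_ord_recr /= subnn g0 mulr1.
by rewrite [fps_div f g n]fps_divE addrC subrK.
Qed.

Lemma fps_div_uniq f g h : g 0 = 1 -> fps_mul h g =1 f -> h =1 fps_div f g.
Proof.
move=> g0 hg n; elim/ltn_ind: n => n IHn.
rewrite fps_divE -hg /fps_mul big_ord_recr /= subnn g0 mulr1.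
under [X in _ = _ - X]eq_bigr => i _ do rewrite -IHn //.
by rewrite addrC addrK.
Qed.

Lemma fps_exp0 f m : f 0 = 1 -> fps_exp f m 0 = 1.
Proof.
by move=> f0; elim: m => //= m IHm; rewrite /fps_mul big_ord1 IHm f0 mulr1.
Qed.

Lemma qpochE (a x : {poly int}) n N :
  a`_0 = 0 -> x`_0 = 0 -> (n < N)%N ->
  qpoch a x n = (\prod_(0 <= k < N) (1 - a * x ^+ k))`_n.
Proof.
have dvdX (p : {poly int}) : p`_0 = 0 -> exists r, p = r * 'X.
  by move=> p0; have /factor_theorem[r ->] : root p 0;
    [rewrite /root horner_coef0 p0 | exists r; rewrite subr0].
move=> /dvdX[b ->] /dvdX[y ->] /subnKC <-; move: (N - _)%N => d.
elim: d => [|d IHd]; first by rewrite addn0.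
rewrite addnS big_nat_recr //= {}IHd mulrBr mulr1 coefB exprMn.
by rewrite mulrACA -exprS mulrA coefMXn ltnS leqW ?leq_addr // subr0.
Qed.

Lemma qpoch0 (a x : {poly int}) : a`_0 = 0 -> qpoch a x 0 = 1.
Proof.
by move=> a0; rewrite /qpoch big_nat1 expr0 mulr1 coefB coef1 a0 subr0.
Qed.

Lemma cseq_genfun (t m : nat) : (0 < t)%N ->
  fps_mul (cseq t m) (fps_exp (qpoch 'X^t 'X^t) m) =1 fps_exp (qpoch 'X 'X) m.
Proof.
move=> t0; apply/fps_divK/fps_exp0/qpoch0.
by rewrite coefXn eq_sym (gtn_eqF t0).
Qed.

(* Main.v *)
From HB Require Import structures.
Require Import Defs.
From mathcomp Require Import all_boot all_order all_algebra.
From mathcomp Require Import zify ring.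
From mathcomp Require Import finmap boolp classical_sets functions cardinality.
From mathcomp Require Import fsbigop.
Set Implicit Arguments.
Unset Strict Implicit.
Unset Printing Implicit Defensive.
Import Order.TTheory GRing.Theory Num.Theory.
Local Open Scope ring_scope.

(** Write c for the quotient (q; q)_oo^m / (q^p; q^p)_oo^m. Its denominator is
    a series in q^p, so the section of c along the class r modulo p, as a
    series in q, is the section of (q; q)_oo^m divided by (q; q)_oo^m
    ([sect_cseq]). The plan is to show that every section has the form
    +- g / (1 - q^d) with g nonnegative ([one_signed]). Such a series keeps one
    sign, and its nonzero terms propagate by the step d, so c is eventually
    periodic in sign with no asymptotic estimate. The classes 0 and 1 carry
    opposite signs because c(0) = 1 and c(1) = - m, and this forces p to divide
    the least period ([sign_periods_of_sections]).

    The numerator is a theta series for m = 1, by the pentagonal number theorem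
    ([phi1E]), and a theta series with linear weights for m = 3, by Jacobi's
    identity for the cube ([phi3E]). Both come from the triple product, which
    is the limit of a finite identity between Gaussian binomials
    ([gsum_prod], [theta_lim], [jacobi_triple_product]); carrying the weight j
    along in the finite identity gives a sum of products with one factor left
    out ([gsum_id]). A section of a theta series selects the indices j for
    which a quadratic polynomial takes a given value modulo p. For odd p there
    are at most two classes of them, exchanged by a symmetry. A class fixed by
    the symmetry gives, up to a monomial and a constant, (q^p; q^p)_oo^m; the
    other cases are as follows.

    For m = 3 the two classes merge into one theta series modulo p with weight
    a j + b, where a and b are nonnegative. Every product that occurs in it
    divides (q; q)_oo^3, and what remains is the inverse of a product of
    factors 1 - q^n ([nonneg_theta_part], [nonneg_theta_weighted]). For m = 1
    and p > 3 the two classes form the theta series of the quintuple product.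
    It is expressed through triple products by multiplying it with a second
    theta series and rearranging the double sum ([quintuple_product]), after
    which (q; q)_oo again cancels all factors of the numerator
    ([nonneg_quin_part]). For m = 1 and p = 3 a section is a single triple
    product modulo 9. For t = 2 the quotient is
    (q; q^2)_oo^m, and replacing q by - q turns it into a series with positive
    coefficients beyond degree 2 ([twist_phi_odd]). *)

(** * The ring of formal power series *)

(** A copy of the type of coefficient sequences, so that the Cauchy product
    is its canonical multiplication: sequences as such carry the pointwise
    product. *)
Definition ps : Type := nat -> int.
HB.instance Definition _ := gen_eqMixin ps.
HB.instance Definition _ := gen_choiceMixin ps.

Section PowerSeriesRing.
Implicit Types f g h : ps.

Let ps0 : ps := fun=> 0.
Let psadd f g : ps := fun n => f n + g n.
Let psopp f : ps := fun n => - f n.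
Let ps1 : ps := fps_one.
Let psmul f g : ps := fps_mul f g.

Let psaddA : associative psadd.
Proof. by move=> f g h; apply/funext => n; rewrite /psadd addrA. Qed.
Let psaddC : commutative psadd.
Proof. by move=> f g; apply/funext => n; rewrite /psadd addrC. Qed.
Let psadd0 : left_id ps0 psadd.
Proof. by move=> f; apply/funext => n; rewrite /psadd add0r. Qed.
Let psaddN : left_inverse ps0 psopp psadd.
Proof. by move=> f; apply/funext => n; rewrite /psadd /psopp addNr. Qed.

HB.instance Definition _ :=
  GRing.isZmodule.Build ps psaddA psaddC psadd0 psaddN.

(* Up to degree n the product of two series is that of the polynomials with
   the same first coefficients, which gives the ring axioms. *)
Let psmulE f g N n : (n < N)%N ->
  psmul f g n = ((\poly_(i < N) f i) * (\poly_(i < N) g i))`_n.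
Proof.
move=> ltnN; rewrite /psmul /fps_mul coefM; apply: eq_bigr => i _.
by rewrite !coef_poly (leq_trans (ltn_ord i)) // (leq_ltn_trans (leq_subr _ _)).
Qed.

Let psmulC : commutative psmul.
Proof.
by move=> f g; apply/funext => n; rewrite !(@psmulE _ _ n.+1) // mulrC.
Qed.
Let psmulA : associative psmul.
Proof.
move=> f g h; apply/funext => n; rewrite !(@psmulE _ _ n.+1) //.
have trunc f' g' : \poly_(i < n.+1) psmul f' g' i = 
    take_poly n.+1 ((\poly_(i < n.+1) f' i) * (\poly_(i < n.+1) g' i)).
  by apply: eq_poly => i lti; rewrite (@psmulE _ _ n.+1).
rewrite !trunc.
have coef_take (P Q : {poly int}) : (P * take_poly n.+1 Q)`_n = (P * Q)`_n.
  rewrite !coefM; apply: eq_bigr => i _; congr (_ * _).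
  by rewrite coef_take_poly ltnS leq_subr.
by rewrite coef_take mulrA [in RHS]mulrC coef_take mulrC.
Qed.
Let psmul1 : left_id ps1 psmul.
Proof.
move=> f; apply/funext => n; rewrite /psmul /fps_mul big_ord_recl /= subn0.
rewrite /ps1 /fps_one eqxx mul1r big1 ?addr0 // => i _.
by rewrite /= mul0r.
Qed.
Let psmulDl : left_distributive psmul +%R.
Proof.
move=> f g h; apply/funext => n; rewrite /psmul /fps_mul.
under eq_bigr do rewrite mulrDl.
by rewrite big_split.
Qed.
Let ps1_neq0 : ps1 != 0.
Proof. by apply/eqP => /(congr1 (fun f : ps => f 0%N)). Qed.

HB.instance Definition _ :=
  GRing.Zmodule_isComNzRing.Build ps psmulA psmulC psmul1 psmulDl ps1_neq0.

End PowerSeriesRing.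

Implicit Types f g h : ps.

Lemma psmE f g n : (f * g) n = \sum_(i < n.+1) f i * g (n - i)%N.
Proof. by []. Qed.
Lemma psaE f g n : (f + g) n = f n + g n. Proof. by []. Qed.
Lemma psoE f n : (- f) n = - f n. Proof. by []. Qed.
Lemma ps1E n : (1 : ps) n = (n == 0)%:R. Proof. by []. Qed.
Lemma psmnE f k n : (f *+ k) n = f n *+ k.
Proof. by elim: k => [|k IHk]; rewrite ?mulr0n // !mulrS psaE IHk. Qed.
Lemma pssumE I (r : seq I) (P : pred I) (F : I -> ps) n :
  (\sum_(i <- r | P i) F i) n = \sum_(i <- r | P i) F i n.
Proof. by apply: (big_morph (fun f : ps => f n)). Qed.
Lemma psm0 f g : (f * g) 0%N = f 0%N * g 0%N.
Proof. by rewrite psmE big_ord1. Qed.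
Lemma psexpE f m : fps_exp f m = f ^+ m.
Proof. by elim: m => //= m IHm; rewrite IHm exprS. Qed.

Definition monom (k : nat) : ps := fun n => (n == k)%:R.

Lemma monom0 : monom 0 = 1. Proof. by apply/funext. Qed.

Lemma monommE k f n : (monom k * f) n = if (k <= n)%N then f (n - k)%N else 0.
Proof.
rewrite psmE; case: ifP => [lekn|ltnk].
  rewrite (bigD1 (Ordinal (lekn : (k < n.+1)%N))) //= /monom eqxx mul1r.
  rewrite big1 ?addr0 // => i; rewrite -val_eqE /= => /negbTE ->.
  by rewrite mul0r.
rewrite big1 // => i _; rewrite /monom; case: eqP => [ik|]; last by rewrite mul0r.
by have := ltn_ord i; rewrite ik ltnS ltnk.
Qed.

Lemma monomD j k : monom (j + k) = monom j * monom k.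
Proof.
apply/funext => n; rewrite monommE /monom; case: leqP => h.
  by congr (_%:R); congr nat_of_bool; apply/eqP/eqP; lia.
by case: eqP => //; lia.
Qed.


(** Congruence modulo q^n. *)
Definition eqm n f g := forall i, (i < n)%N -> f i = g i.

Lemma eqm_refl n f : eqm n f f. Proof. by []. Qed.
Lemma eqm_sym n f g : eqm n f g -> eqm n g f.
Proof. by move=> fg i /fg. Qed.
Lemma eqm_trans n g f h : eqm n f g -> eqm n g h -> eqm n f h.
Proof. by move=> fg gh i lti; rewrite fg ?gh. Qed.
Lemma eqmM n f f' g g' : eqm n f f' -> eqm n g g' -> eqm n (f * g) (f' * g').
Proof.
move=> ff gg i lti; rewrite !psmE; apply: eq_bigr => j _.
by rewrite ff ?gg //; have := ltn_ord j; lia.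
Qed.
Lemma eqmW m n f g : (m <= n)%N -> eqm n f g -> eqm m f g.
Proof. by move=> lemn fg i lti; rewrite fg //; lia. Qed.

Definition nonneg f := forall n, 0 <= f n.

Lemma nonneg1 : nonneg 1. Proof. by move=> n; rewrite ps1E ler0n. Qed.
Lemma nonneg_monom k : nonneg (monom k). Proof. by move=> n; rewrite /monom ler0n. Qed.
Lemma nonnegD f g : nonneg f -> nonneg g -> nonneg (f + g).
Proof. by move=> f0 g0 n; rewrite psaE addr_ge0. Qed.
Lemma nonnegM f g : nonneg f -> nonneg g -> nonneg (f * g).
Proof. by move=> f0 g0 n; rewrite psmE sumr_ge0 // => i _; rewrite mulr_ge0. Qed.
Lemma nonnegMn f k : nonneg f -> nonneg (f *+ k).
Proof. by move=> f0 n; rewrite psmnE mulrn_wge0. Qed.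
Lemma nonneg_exp f k : nonneg f -> nonneg (f ^+ k).
Proof.
move=> f0; elim: k => [|k IHk]; first exact: nonneg1.
by rewrite exprS; apply: nonnegM.
Qed.
Lemma nonneg_prod I (r : seq I) (P : pred I) (F : I -> ps) :
  (forall i, P i -> nonneg (F i)) -> nonneg (\prod_(i <- r | P i) F i).
Proof. by move=> F0; elim/big_ind: _ => //; exact: nonnegM. Qed.
Lemma nonneg_sum I (r : seq I) (P : pred I) (F : I -> ps) :
  (forall i, P i -> nonneg (F i)) -> nonneg (\sum_(i <- r | P i) F i).
Proof. by move=> F0; elim/big_ind: _ => //; exact: nonnegD. Qed.

(** * Infinite products *)

(** The product of a sequence of factors [F i], each congruent to 1 modulo
    q^(i+1). *)
Definition iprod (F : nat -> ps) : ps := fun n => (\prod_(i < n.+1) F i) n.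

Definition cvgprod (F : nat -> ps) := forall i, eqm i.+1 (F i) 1.

Lemma iprod_eqm F N : cvgprod F -> eqm N (iprod F) (\prod_(i < N) F i).
Proof.
move=> F1 n /subnKC <-; rewrite /iprod; move: (N - _)%N => d.
elim: d => [|d IHd]; first by rewrite addn0.
rewrite IHd addnS [in RHS]big_ord_recr /= -[LHS](congr1 (fun f => f n) (mulr1 _)).
by apply: (@eqmM n.+1) => //; apply/eqm_sym/(eqmW _ (F1 _)); lia.
Qed.

Lemma iprod_uniq F f : cvgprod F ->
  (forall n, exists2 N, (n <= N)%N & eqm n f (\prod_(i < N) F i)) -> iprod F = f.
Proof.
move=> F1 fF; apply/funext => n; have [N leN fN] := fF n.+1.
by rewrite (@iprod_eqm _ N) // fN.
Qed.

Lemma cvgprodM F G : cvgprod F -> cvgprod G -> cvgprod (fun i => F i * G i).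
Proof.
by move=> F1 G1 i; have := eqmM (F1 i) (G1 i); rewrite mulr1.
Qed.

Lemma iprodM F G : cvgprod F -> cvgprod G ->
  iprod (fun i => F i * G i) = iprod F * iprod G.
Proof.
move=> F1 G1; apply: iprod_uniq; first exact: cvgprodM.
move=> n; exists n => //; rewrite big_split /=.
by apply: eqmM; apply: iprod_eqm.
Qed.

Lemma nonneg_iprod F : (forall i, nonneg (F i)) -> nonneg (iprod F).
Proof. by move=> F0 n; apply: nonneg_prod. Qed.

Lemma cvgprod_exp F a : cvgprod F -> cvgprod (fun i => F i ^+ a i).
Proof.
move=> F1 i; elim: (a i) => [|k IHk]; rewrite ?expr0 //.
by rewrite exprS; have := eqmM (F1 i) IHk; rewrite mulr1.
Qed.

(** The factor 1 - q^k and, for k > 0, its inverse. *)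
Definition bin k : ps := 1 - monom k.
Definition geo k : ps := fun n => (k %| n)%N%:R.

Lemma binE k : bin k = 1 - monom k. Proof. by []. Qed.

Lemma geoK k : (0 < k)%N -> bin k * geo k = 1.
Proof.
move=> k0; apply/funext => n; rewrite mulrBl mul1r psaE psoE monommE ps1E /geo.
case: leqP => h; last first.
  rewrite subr0; case: n h => [|n] h; first by rewrite dvdn0.
  by congr (_%:R); rewrite gtnNdvd.
rewrite dvdn_subl // subrr; case: eqP => //; lia.
Qed.

Lemma nonneg_geo k : nonneg (geo k).
Proof. by move=> n; rewrite ler0n. Qed.

Lemma bin_eqm k : eqm k (bin k) 1.
Proof.
move=> i lti; rewrite binE psaE psoE /monom; case: eqP => [ik|_]; first by lia.
by rewrite subr0.
Qed.

Lemma geo_eqm k : eqm k (geo k) 1.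
Proof. by move=> [|i] lti; rewrite /geo ?dvdn0 ?ps1E // gtnNdvd. Qed.

Lemma cvg_bin : cvgprod (fun i => bin i.+1).
Proof. by move=> i; apply: bin_eqm. Qed.
Lemma cvg_geo : cvgprod (fun i => geo i.+1).
Proof. by move=> i; apply: geo_eqm. Qed.

(** [euler a] is the product of the (1 - q^n)^(a n) for n > 0, and [part a]
    is its inverse, a generating function of coloured partitions. *)
Definition euler (a : nat -> nat) : ps := iprod (fun i => bin i.+1 ^+ a i.+1).
Definition part (a : nat -> nat) : ps := iprod (fun i => geo i.+1 ^+ a i.+1).

Lemma cvg_euler a : cvgprod (fun i => bin i.+1 ^+ a i.+1).
Proof. by apply: (@cvgprod_exp _ (fun i => a i.+1)); exact: cvg_bin. Qed.
Lemma cvg_part a : cvgprod (fun i => geo i.+1 ^+ a i.+1).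
Proof. by apply: (@cvgprod_exp _ (fun i => a i.+1)); exact: cvg_geo. Qed.

Lemma iprod_ext F G : (forall i, F i = G i) -> iprod F = iprod G.
Proof. by move=> /funext ->. Qed.

Lemma iprod1 : iprod (fun=> 1) = 1.
Proof. by apply/funext => n; rewrite /iprod big1. Qed.

Lemma eulerD a b : euler (fun n => a n + b n)%N = euler a * euler b.
Proof.
rewrite /euler -iprodM; try exact: cvg_euler.
by apply: iprod_ext => i; rewrite exprD.
Qed.

Lemma partD a b : part (fun n => a n + b n)%N = part a * part b.
Proof.
rewrite /part -iprodM; try exact: cvg_part.
by apply: iprod_ext => i; rewrite exprD.
Qed.

Lemma eulerK a : euler a * part a = 1.
Proof.
rewrite -iprodM; [|exact: cvg_euler|exact: cvg_part].
rewrite -iprod1; apply: iprod_ext => i.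
by rewrite -exprMn geoK // expr1n.
Qed.

Lemma euler_ext a b : (forall n, (0 < n)%N -> a n = b n) -> euler a = euler b.
Proof. by move=> ab; apply: iprod_ext => i; rewrite ab. Qed.

Lemma euler_part a b : (forall n, (0 < n)%N -> (a n <= b n)%N) ->
  euler a * part b = part (fun n => b n - a n)%N.
Proof.
move=> ab.
have -> : part b = part (fun n => a n + (b n - a n))%N.
  by apply: iprod_ext => i; rewrite subnKC ?ab.
by rewrite partD mulrA eulerK mul1r.
Qed.

Lemma nonneg_part a : nonneg (part a).
Proof.
by apply: nonneg_iprod => i; apply/nonneg_exp/nonneg_geo.
Qed.

Lemma eulerI a f g : f * euler a = g -> f = g * part a.
Proof. by move=> <-; rewrite -mulrA eulerK mulr1. Qed.

Lemma euler1 k : (0 < k)%N -> euler (fun n => (n == k) : nat) = bin k.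
Proof.
move=> k0; apply: iprod_uniq; first exact: (@cvg_euler (fun n => (n == k) : nat)).
move=> n; exists (n + k)%N; first exact: leq_addr.
have kn : (k.-1 < n + k)%N by lia.
rewrite (bigD1 (Ordinal kn)) //= prednK // eqxx expr1 big1 ?mulr1 //.
move=> i; rewrite -val_eqE /= => ik; have -> : (i.+1 == k) = false by lia.
by rewrite expr0.
Qed.

(** A finite product of factors 1 - q^k times the inverse of a product that
    contains all of them, with multiplicity, is again a partition generating
    function. *)
Lemma nonneg_prod_part (s : seq nat) a :
  (forall k, k \in s -> 0 < k)%N -> (forall k, count_mem k s <= a k)%N ->
  nonneg ((\prod_(k <- s) bin k) * part a).
Proof.
elim: s a => [|k s IHs] a s0 sa; first by rewrite big_nil mul1r; exact: nonneg_part.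
rewrite big_cons mulrAC -euler1; last by rewrite s0 ?inE ?eqxx.
rewrite euler_part; last first.
  move=> n n0; have := sa n; rewrite /= eq_sym; lia.
rewrite mulrC; apply: IHs => [j js|j]; first by rewrite s0 // inE js orbT.
by have := sa j; rewrite /= eq_sym; lia.
Qed.

(** * Signs along arithmetic progressions *)

(** Along each class modulo T the terms vanish, or keep the sign of the first
    nonzero one; only finitely many terms precede the latter. *)
Lemma period_of_sign_absorb (a : nat -> int) T : (0 < T)%N ->
  (forall n, a n != 0 -> Num.sg (a (n + T)%N) = Num.sg (a n)) ->
  period_of_sign a T.
Proof.
move=> T0 aT; split=> //.
have absorb i : exists N, forall k, (N <= k)%N ->
    Num.sg (a (i + T * k)%N) = Num.sg (a (i + T * k + T)%N).
  have [[k0 k0P]|none] := pselect (exists k, a (i + T * k)%N != 0).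
    exists k0 => k /subnKC <-; set d := (k - k0)%N.
    have nz e : a (i + T * (k0 + e))%N != 0.
      elim: e => [|e IHe]; first by rewrite addn0.
      have := aT _ IHe; rewrite -addnA -mulnSr -addnS => h.
      by rewrite -sgr_eq0 h sgr_eq0.
    by rewrite aT.
  have z k : a (i + T * k)%N = 0.
    by apply/eqP/negPn/negP => h; apply: none; exists k.
  by exists 0%N => k _; rewrite -[in RHS]addnA -mulnSr !z.
have [N NP] := choice absorb.
exists (T * \sum_(i < T) N i)%N => n len.
rewrite (divn_eq n T) addnC mulnC; apply: NP.
rewrite (@leq_trans (\sum_(i < T) N i)%N) //.
  by rewrite (bigD1 (Ordinal (ltn_pmod n T0))) //= leq_addr.
by rewrite leq_divRL // mulnC.
Qed.

Lemma period_of_sign_iter (a : nat -> int) T N k n :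
  (forall n, (N <= n)%N -> Num.sg (a n) = Num.sg (a (n + T)%N)) ->
  (N <= n)%N -> Num.sg (a n) = Num.sg (a (n + k * T)%N).
Proof.
move=> aT leN; elim: k => [|k IHk]; first by rewrite addn0.
by rewrite mulSnr addnA -aT ?(leq_trans leN) ?leq_addr.
Qed.

Lemma least_period_exists (a : nat -> int) :
  UPS a -> exists T, least_period_of_sign a T.
Proof.
move=> [T TP].
have ex : exists T, `[< period_of_sign a T >] by exists T; apply/asboolP.
exists (ex_minn ex); case: ex_minnP => T1 /asboolP T1P min.
by split=> // T2 T2P; apply/min/asboolP.
Qed.

(** If a sign is attached to each residue class modulo p and the nonzero terms
    of each class propagate by some fixed step, then p times a common multiple
    of the steps is a period of sign. A period of sign prime to p would carry
    class 0 into class 1, which is impossible when these have opposite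
    signs. *)
Lemma sign_periods_of_sections (a : nat -> int) p : prime p ->
  (forall r, (r < p)%N -> exists (e : bool) (d : nat), [/\ (0 < d)%N,
     forall n, 0 <= (-1) ^+ e * a (p * n + r)%N &
     forall n, a (p * n + r)%N != 0 -> a (p * (n + d) + r)%N != 0]) ->
  0 < a 0%N -> a 1%N < 0 ->
  UPS a /\ exists T, least_period_of_sign a T /\ (p %| T)%N.
Proof.
move=> pp H a0 a1; have p0 := prime_gt0 pp; have p1 := prime_gt1 pp.
have {H} H' : forall r, exists ed : bool * nat, (r < p)%N -> [/\ (0 < ed.2)%N,
     forall n, 0 <= (-1) ^+ ed.1 * a (p * n + r)%N &
     forall n, a (p * n + r)%N != 0 -> a (p * (n + ed.2) + r)%N != 0].
  move=> r; have [rp|rp] := boolP (r < p)%N.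
    by have [e [d h]] := H r rp; exists (e, d).
  by exists (false, 0%N).
have {H'} [ed H] := choice H'.
pose D := (\prod_(r < p) (ed r).2)%N.
have D0 : (0 < D)%N.
  by rewrite prodn_gt0 // => r; case: (H r (ltn_ord r)).
have iterd r n k : (r < p)%N -> a (p * n + r)%N != 0 ->
    a (p * (n + k * (ed r).2) + r)%N != 0.
  move=> rp nz; elim: k => [|k IHk]; first by rewrite addn0.
  by rewrite mulSnr addnA; case: (H r rp) => _ _; apply.
have stepD r n : (r < p)%N -> a (p * n + r)%N != 0 -> a (p * (n + D) + r)%N != 0.
  move=> rp; rewrite /D (bigD1 (Ordinal rp)) //= [X in (n + X)%N]mulnC; exact: iterd.
have sgE r n : (r < p)%N -> a (p * n + r)%N != 0 ->
    Num.sg (a (p * n + r)%N) = (-1) ^+ (ed r).1.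
  move=> rp nz; have [_ /(_ n) + _] := H r rp.
  case: (ed r).1; rewrite ?expr1 ?expr0 ?mulN1r ?mul1r ?oppr_ge0 => h.
    by apply: ltr0_sg; rewrite lt_neqAle nz.
  by apply: gtr0_sg; rewrite lt_neqAle eq_sym nz.
have perD : period_of_sign a (p * D).
  apply: period_of_sign_absorb; first by rewrite muln_gt0 p0.
  move=> n; have rp := ltn_pmod n p0; rewrite {1 3}(divn_eq n p) mulnC => nz.
  have -> : (n + p * D = p * (n %/ p + D) + n %% p)%N.
    by rewrite {1}(divn_eq n p); lia.
  by rewrite !sgE // stepD.
have upsa : UPS a by exists (p * D)%N.
split=> //; have [T TP] := least_period_exists upsa.
exists T; split=> //; have [[T0 [N NP]] _] := TP.
apply: contraT; rewrite -prime_coprime // coprime_sym => /eqP cop.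
(* A multiple of T congruent to 1 modulo p shifts class 0 onto class 1. *)
have [u v uv _] := egcdnP p T0; rewrite cop in uv.
have n0 : a (p * (0 + N * D))%N != 0.
  elim: N {NP} => [|k IHk]; first by rewrite mul0n muln0 gt_eqF.
  have := @stepD 0%N (0 + k * D)%N p0.
  by rewrite !addn0 mulSnr addnA; apply.
set n := (p * (0 + N * D))%N in n0 *.
have leN : (N <= n)%N by rewrite /n add0n mulnC -mulnA leq_pmulr // muln_gt0 D0.
have := period_of_sign_iter u NP leN; rewrite uv.
have -> : (n + (v * p + 1) = p * (0 + N * D + v) + 1)%N by rewrite /n; lia.
have s0 : (-1) ^+ (ed 0%N).1 = 1 :> int.
  by rewrite -(@sgE 0%N 0%N p0) muln0 ?gtr0_sg ?gt_eqF.
have s1 : (-1) ^+ (ed 1%N).1 = -1 :> int.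
  by rewrite -(@sgE 1%N 0%N p1) muln0 ?ltr0_sg ?lt_eqF.
have -> : Num.sg (a n) = 1.
  by have := @sgE 0%N (0 + N * D)%N p0; rewrite addn0 s0; apply.
move=> eq1; have := @sgE 1%N (0 + N * D + v)%N p1; rewrite -eq1 s1.
by rewrite -sgr_eq0 -eq1 => /(_ isT).
Qed.

(** * Sections of a series modulo p *)

Definition sect p r f : ps := fun n => f (p * n + r)%N.

(** f is a series in q^p. *)
Definition lacunary p f := forall n, ~~ (p %| n)%N -> f n = 0.

Lemma lacunaryX p f m : lacunary p f -> lacunary p (f ^+ m).
Proof.
move=> lf; elim: m => [|m IHm] n pn.
  by rewrite expr0 ps1E; case: eqP pn => // ->; rewrite dvdn0.
rewrite exprS psmE big1 // => i _.
have [pi|pi] := boolP (p %| i)%N; last by rewrite lf ?mul0r.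
rewrite [X in _ * X]IHm ?mulr0 // dvdn_subl //; last by have := ltn_ord i; lia.
Qed.

Lemma sectM p r f g : (r < p)%N -> lacunary p g ->
  sect p r (f * g) = sect p r f * sect p 0 g.
Proof.
move=> rp lg; have p0 : (0 < p)%N by lia.
apply/funext => n; rewrite mulrC [RHS](congr1 (fun f : ps => f n) (mulrC _ _)).
rewrite /sect !psmE (bigID (fun i : 'I__ => p %| i)%N) /= [X in _ + X]big1 ?addr0.
  rewrite (reindex_onto (fun j : 'I_n.+1 => inord (p * j)%N)
                        (fun i : 'I_(p * n + r).+1 => inord (i %/ p)%N)) /=.
    have jE (j : 'I_n.+1) : @inord (p * n + r) (p * j)%N = (p * j)%N :> nat.
      by rewrite inordK // ltnS -[X in (X <= _)%N]addn0 leq_add // leq_mul2l -ltnS ltn_ord orbT.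
    apply: eq_big => [j|j _].
      rewrite jE dvdn_mulr //= -val_eqE /= inordK ?mulKn ?eqxx //.
    rewrite jE addn0; congr (_ * f _); have := ltn_ord j; rewrite ltnS -(leq_pmul2l p0) mulnBr => h.
    by rewrite addnBAC.
  move=> i pi; apply/val_inj; rewrite /=.
  have ip : (i %/ p < n.+1)%N.
    by rewrite ltn_divLR // mulSn [(n * p)%N]mulnC; have := ltn_ord i; lia.
  by rewrite (inordK ip) (_ : p * (i %/ p) = i)%N ?inordK // [LHS]mulnC divnK.
by move=> i pi; rewrite lg ?mul0r.
Qed.

Lemma sectX p m f : (0 < p)%N -> lacunary p f ->
  sect p 0 (f ^+ m) = sect p 0 f ^+ m.
Proof.
move=> p0 lf; elim: m => [|m IHm].
  apply/funext => n; rewrite /sect !expr0 !ps1E addn0; congr (_%:R).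
  by rewrite muln_eq0 eqn0Ngt p0.
by rewrite exprSr sectM // IHm exprSr.
Qed.

(** * The generating function *)

Definition ps_of_poly (P : {poly int}) : ps := fun n => P`_n.

Lemma ps_of_poly1 : ps_of_poly 1 = 1.
Proof. by apply/funext => n; rewrite /ps_of_poly coef1. Qed.
Lemma ps_of_polyB P Q : ps_of_poly (P - Q) = ps_of_poly P - ps_of_poly Q.
Proof. by apply/funext => n; rewrite /ps_of_poly coefB. Qed.
Lemma ps_of_polyM P Q : ps_of_poly (P * Q) = ps_of_poly P * ps_of_poly Q.
Proof. by apply/funext => n; rewrite /ps_of_poly coefM. Qed.
Lemma ps_of_polyX k : ps_of_poly 'X^k = monom k.
Proof. by apply/funext => n; rewrite /ps_of_poly coefXn. Qed.

(** [phi] is the Euler product (q; q)_oo. *)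
Definition phi : ps := euler (fun=> 1%N).

Lemma phiE : qpoch 'X 'X = phi.
Proof.
apply/funext => n; rewrite /qpoch /phi /euler /iprod big_mkord.
rewrite -[LHS]/(ps_of_poly _ n); congr (_ n).
rewrite (big_morph _ ps_of_polyM ps_of_poly1); apply: eq_bigr => i _.
by rewrite -exprS ps_of_polyB ps_of_poly1 ps_of_polyX expr1.
Qed.

Lemma qpochXn_coef p n : (0 < p)%N ->
  qpoch 'X^p 'X^p n = if (p %| n)%N then phi (n %/ p)%N else 0.
Proof.
move=> p0; rewrite -phiE /qpoch.
have -> : \prod_(0 <= k < n.+1) (1 - 'X^p * 'X^p ^+ k) =
    (\prod_(0 <= k < n.+1) (1 - 'X * 'X ^+ k)) \Po 'X^p :> {poly int}.
  rewrite rmorph_prod; apply: eq_bigr => k _ /=.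
  by rewrite rmorphB rmorph1 rmorphM rmorphXn /= comp_polyX.
rewrite coef_comp_poly_Xn //; case: ifP => // _.
by symmetry; apply: qpochE; rewrite ?coefX // ltnS leq_div.
Qed.

Lemma cseq_mul p m : (0 < p)%N ->
  (cseq p m : ps) * (qpoch 'X^p 'X^p : ps) ^+ m = phi ^+ m.
Proof.
by move=> p0; rewrite -!psexpE -phiE; apply/funext; exact: cseq_genfun.
Qed.

Lemma cseq_01 p m : (1 < p)%N -> cseq p m 0%N = 1 /\ cseq p m 1%N = - m%:Z.
Proof.
move=> p1; have p0 : (0 < p)%N by lia.
have pow (f : ps) k : f 0%N = 1 -> (f ^+ k) 0%N = 1 /\ (f ^+ k) 1%N = f 1%N *+ k.
  move=> f0; elim: k => [|k [IH0 IH1]]; first by rewrite expr0 !ps1E mulr0n.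
  rewrite exprS psm0 psmE !big_ord_recl big_ord0 /= IH0 IH1 f0 addr0 mulr1 mul1r.
  by rewrite mulrS addrC mulr1.
set g : ps := qpoch 'X^p 'X^p.
have g0 : g 0%N = 1 by rewrite /g qpoch0 // coefXn eq_sym gtn_eqF.
have phi0 : phi 0%N = 1 by rewrite -phiE qpoch0 // coefX.
have g1 : g 1%N = 0 by rewrite /g qpochXn_coef // dvdn1 gtn_eqF.
have phi1 : phi 1%N = -1.
  rewrite /phi /euler /iprod !big_ord_recl big_ord0 !expr1 mulr1 psmE.
  by rewrite !big_ord_recl big_ord0 !binE !psaE !psoE.
have E := cseq_mul m p0; rewrite -/g in E.
have [gm0 gm1] := pow g m g0; have [pm0 pm1] := pow phi m phi0.
have c0 : cseq p m 0%N = 1.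
  by have := congr1 (fun f : ps => f 0%N) E; rewrite psm0 gm0 pm0 mulr1.
split=> //; have := congr1 (fun f : ps => f 1%N) E.
rewrite psmE !big_ord_recl big_ord0 /= gm0 gm1 pm1 phi1 g1 mul0rn mulr0 add0r.
by rewrite /bump /= addr0 mulr1 => ->; rewrite mulNrn natz.
Qed.

(** Since (q^p; q^p)_oo is a series in q^p, a section of the quotient is the
    section of the numerator divided by a power of (q; q)_oo. *)
Lemma sect_cseq p m r : (r < p)%N ->
  sect p r (cseq p m) * phi ^+ m = sect p r (phi ^+ m).
Proof.
move=> rp; have p0 : (0 < p)%N by lia.
pose g : ps := qpoch 'X^p 'X^p.
have lg : lacunary p g by move=> n pn; rewrite /g qpochXn_coef // (negbTE pn).
have g0 : sect p 0 g = phi.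
  by apply/funext => n; rewrite /sect /g qpochXn_coef // addn0 dvdn_mulr // mulKn.
have := cseq_mul m p0; rewrite -/g => /(congr1 (sect p r)); rewrite sectM //; last exact: lacunaryX.
by rewrite sectX // g0.
Qed.


(** * Theta-like series *)

Local Open Scope classical_set_scope.

(** The series of the [u i] q^(e i / 2) over an arbitrary index type. Doubling
    the exponents avoids divisions in exponents such as i(3i-1)/2. *)
Definition gser (T : choiceType) (e : T -> int) (u : T -> int) : ps :=
  fun n => \sum_(i \in [set i | e i == (2 * n)%:Z]) u i.

Definition evenly (T : Type) (e : T -> int) :=
  forall i, exists k : nat, e i = (2 * k)%:Z.

Definition coercive (T : Type) (e : T -> int) :=
  forall n : int, finite_set [set i | e i <= n].

Lemma gserE (T : choiceType) (e u : T -> int) n (s : seq T) : uniq s ->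
  (forall i, e i = (2 * n)%:Z -> i \in s) ->
  gser e u n = \sum_(i <- s | e i == (2 * n)%:Z) u i.
Proof.
move=> us es; rewrite /gser -(@bigfs _ _ _ _ s) // => i ei.
by rewrite (es i) //; apply/eqP.
Qed.

Lemma gser_ext (T : choiceType) (e u e' u' : T -> int) :
  (forall i, e i = e' i) -> (forall i, u i = u' i) -> gser e u = gser e' u'.
Proof. by move=> /funext -> /funext ->. Qed.

Lemma gser_scale (T : choiceType) (e u : T -> int) (b : bool) :
  gser e (fun i => (-1) ^+ b * u i) = (-1) ^+ b * gser e u.
Proof.
apply/funext => n; rewrite /gser -mulr_fsumr.
by case: b; rewrite ?expr0 ?expr1 ?mul1r // !mulN1r psoE.
Qed.

Lemma coercive_seq (T : choiceType) (e : T -> int) n : coercive e ->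
  exists s : seq T, uniq s /\ forall i, (i \in s) = (e i <= n).
Proof.
move=> /(_ n) fe; exists (fset_set [set i | e i <= n]); split; first exact: fset_uniq.
by move=> i; rewrite in_fset_set // ; apply/idP/idP; rewrite inE.
Qed.

Lemma coercive_pair (T T' : choiceType) (e : T -> int) (e' : T' -> int) :
  evenly e -> evenly e' -> coercive e -> coercive e' ->
  coercive (fun x : T * T' => e x.1 + e' x.2).
Proof.
move=> ee ee' ce ce' n.
apply: (@sub_finite_set _ _ ([set i | e i <= n] `*` [set i | e' i <= n])).
  move=> [i j] /= h; have [k ek] := ee i; have [k' ek'] := ee' j.
  by split=> /=; lia.
exact: finite_setX.
Qed.

Lemma gserM (T T' : choiceType) (e u : T -> int) (e' u' : T' -> int) :
  evenly e -> evenly e' -> coercive e -> coercive e' ->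
  gser e u * gser e' u' = gser (fun x => e x.1 + e' x.2) (fun x => u x.1 * u' x.2).
Proof.
move=> ee ee' ce ce'; apply/funext => n.
have [s [us sE]] := coercive_seq (2 * n)%:Z ce.
have [t [ut tE]] := coercive_seq (2 * n)%:Z ce'.
have ge0 i : 0 <= e i by have [k ->] := ee i.
have ge0' i : 0 <= e' i by have [k ->] := ee' i.
rewrite (@gserE _ _ _ _ [seq (i, j) | i <- s, j <- t]); first last.
- move=> [i j] /= h; apply/allpairsP; exists (i, j); rewrite sE tE /=.
  have := ge0 i; have := ge0' j; split=> //; lia.
- by apply: allpairs_uniq => // -[? ?] [? ?] _ _ [-> ->].
rewrite big_mkcond big_allpairs psmE.
transitivity (\sum_(a < n.+1) \sum_(i <- s) \sum_(j <- t)
    if (e i == (2 * a)%:Z) && (e' j == (2 * (n - a))%:Z) then u i * u' j else 0).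
  apply: eq_bigr => a _; have := ltn_ord a; rewrite ltnS => lean.
  rewrite (@gserE _ e _ _ s) //; last by move=> i ei; rewrite sE; lia.
  rewrite (@gserE _ e' _ _ t) //; last by move=> i ei; rewrite tE; lia.
  rewrite big_mkcond mulr_suml; apply: eq_bigr => i _.
  rewrite mulr_sumr big_mkcond /=; apply: eq_bigr => j _.
  by case: (e i == _); case: (e' j == _); rewrite ?mul0r ?mulr0.
rewrite exchange_big; apply: eq_bigr => i _.
rewrite exchange_big; apply: eq_bigr => j _ /=.
have [k ek] := ee i; have [k' ek'] := ee' j.
have [eq|neq] := eqVneq (e i + e' j) (2 * n)%:Z.
  have kn : (k < n.+1)%N by lia.
  rewrite (bigD1 (Ordinal kn)) //= big1 ?addr0.
    by rewrite ifT //; apply/andP; split; apply/eqP; lia.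
  move=> a; rewrite -val_eqE /= => ak; rewrite ifF //.
  by apply/negbTE/negP => /andP[/eqP h _]; move/eqP: ak; apply; lia.
rewrite big1 // => a _; rewrite ifF //.
apply/negbTE/negP => /andP[/eqP h /eqP h']; move/eqP: neq; apply.
by have := ltn_ord a; lia.
Qed.

(** When [h] parametrizes the indices whose exponent is r modulo p, the section
    is the series of the new exponents [e]. The constant c is not assumed to
    have the form 2(pC + r): the given index [i1] of the section shows it. *)
Lemma sect_gser (T T' : choiceType) p r (e u : T -> int) (e' u' : T' -> int)
    (h : T -> T') (c : int) i1 n1 :
  (r < p)%N -> injective h -> evenly e -> 0 <= c ->
  (forall i, e' (h i) = p%:Z * e i + c) ->
  (forall i, u' (h i) = u i) ->
  (forall j n, e' j = (2 * (p * n + r))%:Z -> exists i, h i = j) ->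
  e' (h i1) = (2 * (p * n1 + r))%:Z ->
  exists C, sect p r (gser e' u') = monom C * gser e u.
Proof.
move=> rp hinj ee c0 eh uh surj; have p0 : (0 < p)%N by lia.
have [k1 ek1] := ee i1; rewrite eh ek1 => E1.
have lek : (k1 <= n1)%N.
  rewrite leqNgt; apply/negP => ltk.
  have : (p * k1 >= p * n1 + p)%N by rewrite addnC -mulnS leq_mul2l ltk orbT.
  by lia.
exists (n1 - k1)%N; set C := (n1 - k1)%N.
have cE : c = (2 * (p * C + r))%:Z.
  have -> : (p * C = p * n1 - p * k1)%N by rewrite /C mulnBr.
  have : (p * k1 <= p * n1)%N by rewrite leq_mul2l lek orbT.
  by lia.
apply/funext => n; rewrite monommE; case: leqP => [leC|ltn].
  rewrite /sect /gser (@reindex_fsbig _ _ _ _ _ h [set i | e i == (2 * (n - C))%:Z]).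
    by apply: eq_fsbigr => i _; rewrite uh.
  have key i : (e' (h i) == (2 * (p * n + r))%:Z) = (e i == (2 * (n - C))%:Z).
    have -> : (e' (h i) == (2 * (p * n + r))%:Z) =
              (p%:Z * e i == p%:Z * (2 * (n - C))%:Z).
      rewrite eh cE; apply/eqP/eqP; nia.
    by rewrite (inj_eq (mulfI _)) // eqz_nat -lt0n.
  split=> [i /= | i j _ _ | j /= /eqP ej].
  - by rewrite key.
  - exact: hinj.
  - have [i hi] := surj j n ej; exists i => //=.
    by rewrite -key hi ej.
rewrite /sect /gser (_ : [set i | _] = set0) ?fsbig_set0 //.
apply/seteqP; split=> // j /= /eqP ej; have [i hi] := surj j n ej.
move: ej; rewrite -hi eh cE; have [k ->] := ee i.
have : (p * n < p * C)%N by rewrite ltn_mul2l p0.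
by have : 0 <= p%:Z * (2 * k)%:Z :> int; [lia | nia].
Qed.

Lemma sect_gser0 (T' : choiceType) p r (e' u' : T' -> int) :
  ~ (exists j n, e' j = (2 * (p * n + r))%:Z) -> sect p r (gser e' u') = 0.
Proof.
move=> none; apply/funext => n; rewrite /sect /gser.
rewrite (_ : [set i | _] = set0) ?fsbig_set0 //.
by apply/seteqP; split=> // j /= /eqP ej; apply: none; exists j, n.
Qed.

(** The sign-reversing involution [flip] makes the terms outside [keep] cancel
    in pairs; [h] reindexes the surviving ones. *)
Lemma gser_cancel (T T' : choiceType) (e u : T -> int) (e' u' : T' -> int)
    (keep : T -> bool) (h : T -> T') (flip : T -> T) :
  coercive e ->
  (forall x, ~~ keep x -> [/\ ~~ keep (flip x), flip (flip x) = x,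
     e (flip x) = e x & u (flip x) = - u x]) ->
  (forall x, keep x -> e' (h x) = e x /\ u' (h x) = u x) ->
  {in keep &, injective h} ->
  (forall y, exists2 x, keep x & h x = y) ->
  gser e u = gser e' u'.
Proof.
move=> ce Hf Hh hinj surj; apply/funext => n; rewrite /gser.
set A := [set i | _]; set B := [set i | e' i == _].
rewrite (fsbigID [set x | keep x]); last first.
  by apply: sub_finite_set (ce (2 * n)%:Z) => x /= /eqP ->.
rewrite [X in _ + X = _](_ : _ = 0) ?addr0.
  rewrite [RHS](@reindex_fsbig _ _ _ _ _ h (A `&` [set x | keep x])).
    by apply: eq_fsbigr => x; rewrite inE => -[_ /= kx]; case: (Hh x kx).
  split=> [x [/= ex kx] | x y | y /= ey].
  - by rewrite /B /=; case: (Hh x kx) => ->.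
  - by rewrite !inE => -[_ kx] [_ ky]; apply: hinj.
  - have [x kx hx] := surj y; exists x => //; split=> //=.
    by rewrite /A /=; case: (Hh x kx) => <- _; rewrite hx.
set S := \sum_(_ \in _) _.
have : S = - S; last by lia.
rewrite {1}/S (@reindex_fsbig _ _ _ _ _ flip (A `&` ~` [set x | keep x])).
  rewrite -mulN1r /S mulr_fsumr; apply: eq_fsbigr => x.
  by rewrite inE => -[_ /= /negP kx]; case: (Hf x kx) => _ _ _ ->; rewrite mulN1r.
split=> [x [/= ex /negP kx] | x y | x [/= ex /negP kx]].
- by case: (Hf x kx) => /negP k1 _ e1 _; split=> //; rewrite /A /= e1.
- rewrite !inE => -[_ /negP kx] [_ /negP ky] E.
  by case: (Hf x kx) => _ <- _ _; case: (Hf y ky) => _ <- _ _; rewrite E.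
- case: (Hf x kx) => /negP k1 f1 e1 _; exists (flip x) => //.
  by split=> //; rewrite /A /= e1.
Qed.

Lemma finite_int_ball (B : nat) : finite_set [set i : int | (`|i| <= B)%N].
Proof.
apply: (@sub_finite_set _ _ ((fun k : nat => k%:Z - B%:Z) @` `I_(2 * B).+1)).
  move=> i /= h; exists (absz (i + B%:Z)); rewrite /=; lia.
exact/finite_image/finite_II.
Qed.

Lemma coercive_int (e : int -> int) :
  (forall i, (`|i|%N)%:Z <= e i + 1) -> coercive e.
Proof.
move=> eb n; apply: sub_finite_set (finite_int_ball (absz (n + 1))) => i /= h.
by have := eb i; lia.
Qed.

Lemma coercive_bool (e : bool * int -> int) :
  (forall b i, (`|i|%N)%:Z <= e (b, i) + 1) -> coercive e.
Proof.
move=> eb n.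
apply: (@sub_finite_set _ _ ([set: bool] `*` [set i | (`|i| <= absz (n + 1)%R)%N])).
  by move=> [b i] /= h; split=> //=; have := eb b i; lia.
by apply: finite_setX; [exact: finite_finset|exact: finite_int_ball].
Qed.


(** * The Jacobi triple product *)

(** The triangular number j(j-1)/2. *)
Definition tri (j : int) : nat :=
  match j with Posz n => 'C(n, 2) | Negz n => 'C(n.+2, 2) end.

Lemma triE j : (2 * (tri j)%:Z = j * (j - 1))%R.
Proof.
have binE n : (2 * ('C(n, 2))%:Z = n%:Z * (n%:Z - 1))%R.
  by elim: n => // n IHn; rewrite binS bin1; nia.
by case: j => n; rewrite /tri binE // NegzE; nia.
Qed.

(** Sums over a symmetric range of integers. The shift lemmas need the terms to
    vanish at its ends only, so that B may exceed the support. *)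
Definition tsum (B : nat) (a : int -> ps) : ps :=
  \sum_(k < (2 * B).+1) a (k%:Z - B%:Z).

Lemma tsum_shiftl B a : a (- B%:Z - 1) = 0 -> a B%:Z = 0 ->
  tsum B (fun j => a (j - 1)) = tsum B a.
Proof.
move=> a0 aB; rewrite /tsum big_ord_recl [in RHS]big_ord_recr /=.
rewrite (_ : 0%:Z - B%:Z - 1 = - B%:Z - 1) ?a0 ?add0r; last by lia.
rewrite (_ : (2 * B)%:Z - B%:Z = B%:Z) ?aB ?addr0; last by lia.
by apply: eq_bigr => k _; congr a; rewrite /bump /=; lia.
Qed.

Lemma tsum_shiftr B a : a (B%:Z + 1) = 0 -> a (- B%:Z) = 0 ->
  tsum B (fun j => a (j + 1)) = tsum B a.
Proof.
move=> aB a0; rewrite /tsum big_ord_recr [in RHS]big_ord_recl /=.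
rewrite (_ : (2 * B)%:Z - B%:Z + 1 = B%:Z + 1) ?aB ?addr0; last by lia.
rewrite (_ : 0%:Z - B%:Z = - B%:Z) ?a0 ?add0r; last by lia.
by apply: eq_bigr => k _; congr a; rewrite /bump /=; lia.
Qed.

Lemma eq_tsum B a b : (forall j, (absz j <= B)%N -> a j = b j) ->
  tsum B a = tsum B b.
Proof.
by move=> ab; apply: eq_bigr => k _; apply: ab; have := ltn_ord k; lia.
Qed.

Lemma tsumD B a b : tsum B (fun j => a j + b j) = tsum B a + tsum B b.
Proof. exact: big_split. Qed.

Lemma tsumZ B c a : tsum B (fun j => c * a j) = c * tsum B a.
Proof. by rewrite /tsum mulr_sumr. Qed.

Definition psC (c : int) : ps := c%:~R.

Lemma psCE c f n : (psC c * f) n = c * f n.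
Proof.
rewrite /psC mulrzl; case: c => k; rewrite ?NegzE ?mulrNz ?psoE -pmulrn psmnE.
  by rewrite -mulr_natl natz.
by rewrite mulNr -mulr_natl natz.
Qed.

Lemma signr_flip a b : odd a = ~~ odd b -> (-1) ^+ a = - (-1) ^+ b :> int.
Proof. by move=> ab; rewrite -signr_odd ab signrN signr_odd. Qed.

Section GaussianBinomials.
Variable M : nat.
Local Notation x k := (monom (M * k)).

(** The Gaussian binomial [2N choose N+j] in base x, given by the recurrence
    that the product with 1 - (z + w) x^N + x^(2N+1) imposes. *)
Fixpoint cgauss (N : nat) (j : int) : ps :=
  if N is k.+1 then
    (1 + x ((2 * k).+1)) * cgauss k j + x (absz (k%:Z - j + 1)%R) * cgauss k (j - 1)
      + x (absz (k%:Z + j + 1)%R) * cgauss k (j + 1)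
  else (j == 0)%:R.

Lemma cgauss0 N j : (N < (absz (j)%R))%N -> cgauss N j = 0.
Proof.
elim: N j => [|k IHk] j h /=; first by case: eqP h => // ->.
by rewrite !IHk ?mulr0 ?addr0 //; lia.
Qed.

(** The finite product (x; x)_k. *)
Definition qfact k : ps := \prod_(i < k) bin (M * i.+1).

Lemma qfactS k : qfact k.+1 = qfact k * bin (M * k.+1).
Proof. exact: big_ord_recr. Qed.

(** The closed form (x; x)_2N / ((x; x)_(N-j) (x; x)_(N+j)) of [cgauss], with
    the denominators cleared. *)
Lemma cgaussE N j : ((absz (j)%R) <= N)%N ->
  cgauss N j * qfact (absz (N%:Z - j)%R) * qfact (absz (N%:Z + j)%R) = qfact (2 * N).
Proof.
elim: N j => [|N IHN] j hj.
  have -> : j = 0 by lia.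
  by rewrite /= muln0 /qfact !big_ord0 !mulr1.
have x0 : x 0 = 1 by rewrite muln0 monom0.
(* The three terms of the recurrence, over the common denominator; a term
   that leaves the range is cancelled by a factor 1 - x^0. *)
set D := qfact (absz (N.+1%:Z - j)%R) * qfact (absz (N.+1%:Z + j)%R).
have T0 : cgauss N j * D =
    bin (M * (absz (N.+1%:Z - j)%R)) * bin (M * (absz (N.+1%:Z + j)%R)) * qfact (2 * N).
  have [h|h] := leqP (absz (j)%R) N.
    rewrite -(IHN j h) /D.
    have -> : (absz (N.+1%:Z - j)%R) = ((absz (N%:Z - j)%R)).+1 by lia.
    have -> : (absz (N.+1%:Z + j)%R) = ((absz (N%:Z + j)%R)).+1 by lia.
    by rewrite !qfactS; ring.
  rewrite cgauss0 // mul0r /bin.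
  have [->|->] : j = N.+1 \/ j = - N.+1%:Z by lia.
    by rewrite subrr x0 subrr !mul0r.
  by rewrite subrr x0 subrr mulr0 mul0r.
have T1 : - N%:Z <= j -> cgauss N (j - 1) * D =
    bin (M * (absz (N%:Z + j)%R)) * bin (M * (absz (N.+1%:Z + j)%R)) * qfact (2 * N).
  move=> h; have [h1|h1] := leqP (absz (j - 1)%R) N.
    rewrite -(IHN _ h1) /D.
    have -> : (absz (N.+1%:Z + j)%R) = ((absz (N%:Z + (j - 1))%R)).+2 by lia.
    have -> : (absz (N%:Z + j)%R) = ((absz (N%:Z + (j - 1))%R)).+1 by lia.
    have -> : (absz (N.+1%:Z - j)%R) = (absz (N%:Z - (j - 1))%R) by lia.
    by rewrite !qfactS; ring.
  rewrite cgauss0 // mul0r /bin; have -> : j = - N%:Z by lia.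
  by rewrite addrN x0 subrr !mul0r.
have T2 : j <= N%:Z -> cgauss N (j + 1) * D =
    bin (M * (absz (N%:Z - j)%R)) * bin (M * (absz (N.+1%:Z - j)%R)) * qfact (2 * N).
  move=> h; have [h1|h1] := leqP (absz (j + 1)%R) N.
    rewrite -(IHN _ h1) /D.
    have -> : (absz (N.+1%:Z - j)%R) = ((absz (N%:Z - (j + 1))%R)).+2 by lia.
    have -> : (absz (N%:Z - j)%R) = ((absz (N%:Z - (j + 1))%R)).+1 by lia.
    have -> : (absz (N.+1%:Z + j)%R) = (absz (N%:Z + (j + 1))%R) by lia.
    by rewrite !qfactS; ring.
  rewrite cgauss0 // mul0r /bin; have -> : j = N by lia.
  by rewrite subrr x0 subrr !mul0r.
rewrite -mulrA -/D /= mulrDl mulrDl -!mulrA T0.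
have -> : (2 * N.+1 = (2 * N).+2)%N by lia.
rewrite !qfactS.
have xx a b c : (a + b = c)%N -> x c = x a * x b.
  by move=> <-; rewrite mulnDr monomD.
have [jlo|jlo] := ltrP j (- N%:Z).
  have jE : j = - N.+1%:Z by lia.
  rewrite T2; last by lia.
  rewrite [cgauss N (j - 1)]cgauss0 ?mul0r ?mulr0; last by lia.
  have -> : (absz (N.+1%:Z + j)%R) = 0%N by lia.
  have -> : (absz (N%:Z + j + 1)%R) = 0%N by lia.
  have -> : (absz (N%:Z - j)%R) = (2 * N).+1 by lia.
  have -> : (absz (N.+1%:Z - j)%R) = (2 * N).+2 by lia.
  by rewrite /bin x0; ring.
have [jhi|jhi] := ltrP N%:Z j.
  have jE : j = N.+1 by lia.
  rewrite T1; last by lia.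
  rewrite [cgauss N (j + 1)]cgauss0 ?mul0r ?mulr0; last by lia.
  have -> : (absz (N.+1%:Z - j)%R) = 0%N by lia.
  have -> : (absz (N%:Z - j + 1)%R) = 0%N by lia.
  have -> : (absz (N%:Z + j)%R) = (2 * N).+1 by lia.
  have -> : (absz (N.+1%:Z + j)%R) = (2 * N).+2 by lia.
  by rewrite /bin x0; ring.
rewrite T1 // T2 //.
have -> : (absz (N%:Z - j + 1)%R) = (absz (N.+1%:Z - j)%R) by lia.
have -> : (absz (N%:Z + j + 1)%R) = (absz (N.+1%:Z + j)%R) by lia.
rewrite /bin (xx (absz (N.+1%:Z - j)%R) (absz (N.+1%:Z + j)%R) (2 * N).+2); last by lia.
have E1 : x ((2 * N).+1) = x (absz (N.+1%:Z - j)%R) * x (absz (N%:Z + j)%R).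
  by apply: xx; lia.
have E2 : x ((2 * N).+1) = x (absz (N.+1%:Z + j)%R) * x (absz (N%:Z - j)%R).
  by apply: xx; lia.
move: (qfact (2 * N)) E1 E2; move: (x ((2 * N).+1)) => c Q.
move: (x (absz (N.+1%:Z - j)%R)) (x (absz (N.+1%:Z + j)%R)) => a b.
move: (x (absz (N%:Z - j)%R)) (x (absz (N%:Z + j)%R)) => a' b' E1 E2.
transitivity (Q * (1 - c) * (1 - a * b) + (c - a * b') * ((1 - b) * Q)
              + (c - b * a') * ((1 - a) * Q)); first by ring.
by rewrite -E1 -E2 subrr !mul0r !addr0.
Qed.

Hypothesis M0 : (0 < M)%N.

Lemma euler_prog k : (0 < k <= M)%N ->
  iprod (fun j => bin (k + M * j)) = euler (fun n => (n %% M == k %% M)%N : nat).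
Proof.
move=> /andP[k0 kM]; apply: iprod_uniq.
  by move=> j; apply: eqmW (@bin_eqm _); nia.
move=> n; exists n => //.
have -> m : \prod_(j < m) bin (k + M * j) =
    \prod_(i < M * m) bin i.+1 ^+ (i.+1 %% M == k %% M)%N.
  elim: m => [|m IHm]; first by rewrite muln0 !big_ord0.
  rewrite big_ord_recr /= IHm mulnSr big_split_ord /=; congr (_ * _).
  have kM1 : (k.-1 < M)%N by lia.
  rewrite (bigD1 (Ordinal kM1)) //= [X in _ * X]big1 ?mulr1.
    by rewrite -addnS prednK // mulnC modnMDl eqxx expr1 addnC mulnC.
  move=> i; rewrite -val_eqE /= -addnS mulnC modnMDl => ik.
  have ltiM := ltn_ord i.
  suff -> : (i.+1 %% M == k %% M)%N = false by rewrite expr0.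
  have [iM|iM] := eqVneq i.+1 M.
    by rewrite iM modnn eq_sym; apply/negbTE; rewrite modn_small; lia.
  rewrite modn_small; last by lia.
  have [->|kM'] := eqVneq k M; first by rewrite modnn.
  by rewrite modn_small; lia.
apply: (@eqmW _ (M * n)); first exact: leq_pmull.
exact: (iprod_eqm (@cvg_euler (fun n => (n %% M == k %% M)%N : nat))).
Qed.

Definition eulerM : ps := euler (fun n => (M %| n)%N : nat).

Lemma eulerM_eqm m k : (m <= k)%N -> eqm m (qfact k) eulerM.
Proof.
move=> lemk; rewrite /eulerM.
have -> : euler (fun n => (M %| n)%N : nat) = iprod (fun j => bin (M * j.+1)).
  have := @euler_prog M; rewrite M0 leqnn => /(_ isT).
  by rewrite modnn => E; rewrite -[LHS]E; apply: iprod_ext => j; rewrite mulnS.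
apply/eqm_sym/(eqmW lemk)/iprod_eqm => j; apply: eqmW (@bin_eqm _); nia.
Qed.

Lemma cgauss_lim N j m : (absz j + m <= N)%N -> eqm m (eulerM * cgauss N j) 1.
Proof.
move=> le.
have E : eqm m (cgauss N j * eulerM * eulerM) eulerM.
  apply: (@eqm_trans _ (qfact (2 * N))); last by apply: eulerM_eqm; lia.
  rewrite -(@cgaussE N j); last by lia.
  by apply: eqmM; [apply: eqmM => //|]; apply/eqm_sym/eulerM_eqm; lia.
have := eqmM E (@eqm_refl m (part (fun n => (M %| n)%N : nat))).
by rewrite -mulrA eulerK mulr1 mulrC.
Qed.

End GaussianBinomials.

Section TripleProduct.
Variables (M s : nat).
Hypotheses (M0 : (0 < M)%N) (s0 : (0 < s)%N) (sM : (s <= M)%N).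

(** With x = q^M, z = q^s and w = q^(M-s), the two families of factors of the
    product are 1 - z x^j and 1 - w x^j, and zw = x. *)
Local Notation x k := (monom (M * k)).
Local Notation z := (monom s).
Local Notation w := (monom (M - s)).
Local Notation cgauss := (cgauss M).
Local Notation eulerM := (eulerM M).

(** The exponent of (-1)^j z^j x^(j(j-1)/2), and its double. *)
Definition texp (j : int) : nat := (absz (M%:Z * (tri j)%:Z + s%:Z * j)%R).
Definition texp2 (M s : nat) (j : int) : int :=
  M%:Z * (j * (j - 1)) + (2 * s)%:Z * j.

Lemma texp2E j : texp2 M s j = (2 * texp j)%:Z.
Proof.
rewrite /texp2 /texp -triE.
suff : 0 <= M%:Z * (tri j)%:Z + s%:Z * j by lia.
have := triE j; case: (lerP 0 j) => j0 h; first by nia.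
have : - j <= (tri j)%:Z by nia.
by nia.
Qed.

Lemma evenly_texp2 : evenly (texp2 M s).
Proof. by move=> j; exists (texp j); rewrite texp2E. Qed.

Lemma texp_ge j : ((absz (j)%R) <= 2 * texp j + 1)%N.
Proof.
have := texp2E j; rewrite /texp2.
have [t Mt] : exists t, M = (s + t)%N by exists (M - s)%N; lia.
have -> : M%:Z * (j * (j - 1)) + (2 * s)%:Z * j =
    s%:Z * (j * (j + 1)) + t%:Z * (j * (j - 1)).
  by rewrite Mt PoszD PoszM; ring.
move: (texp j) => e.
have a0 : 0 <= j * (j - 1) by rewrite -triE.
have b0 : 0 <= j * (j + 1) by have := triE (j + 1); nia.
have tj : 0 <= t%:Z * (j * (j - 1)) by apply: mulr_ge0.
have sj : j * (j + 1) <= s%:Z * (j * (j + 1)) by apply: ler_peMl => //; lia.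
move=> h; have {}h : j * (j + 1) <= (2 * e)%:Z by lia.
by case: (lerP 0 j) => j0; nia.
Qed.

Lemma coercive_texp2 : coercive (texp2 M s).
Proof. by apply: coercive_int => j; rewrite texp2E; have := texp_ge j; lia. Qed.

Lemma texpD j : (texp j)%:Z = (texp (j - 1))%:Z + M%:Z * (j - 1) + s%:Z.
Proof.
by have := texp2E j; have := texp2E (j - 1); rewrite /texp2; nia.
Qed.

(** The sum that converges to the theta series weighted by [u], after
    multiplication by (x; x)_oo. *)
Definition gsum B N (u : int -> int) : ps :=
  tsum B (fun j => psC ((-1) ^+ (absz j) * u j) * (monom (texp j) * cgauss N j)).

(** Shifting j by one in the last two terms of the recurrence of [cgauss]
    splits off the factors z x^N and w x^N and changes the sign; it also shifts
    the weight, which is why weights are carried along. *)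
Lemma gsumS B N u : (N < B)%N ->
  gsum B N.+1 u = (1 + x ((2 * N).+1)) * gsum B N u
    - z * x N * gsum B N (fun j => u (j + 1))
    - w * x N * gsum B N (fun j => u (j - 1)).
Proof.
move=> ltNB.
have sgn1 j : (-1) ^+ absz (j + 1) = - (-1) ^+ absz j :> int.
  by apply: signr_flip; lia.
have sgnm j : (-1) ^+ absz (j - 1) = - (-1) ^+ absz j :> int.
  by apply: signr_flip; lia.
have -> : gsum B N (fun j => u (j + 1)) = tsum B (fun j =>
    psC ((-1) ^+ absz (j - 1) * u j) * (monom (texp (j - 1)) * cgauss N (j - 1))).
  rewrite /gsum -tsum_shiftl; first by apply: eq_tsum => j _; rewrite subrK.
  - by rewrite cgauss0 ?mulr0 //; lia.
  - by rewrite cgauss0 ?mulr0 //; lia.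
have -> : gsum B N (fun j => u (j - 1)) = tsum B (fun j =>
    psC ((-1) ^+ absz (j + 1) * u j) * (monom (texp (j + 1)) * cgauss N (j + 1))).
  rewrite /gsum -tsum_shiftr; first by apply: eq_tsum => j _; rewrite addrK.
  - by rewrite cgauss0 ?mulr0 //; lia.
  - by rewrite cgauss0 ?mulr0 //; lia.
rewrite -!mulNr -!tsumZ -!tsumD; apply: eq_tsum => j hj /=.
rewrite sgn1 sgnm !mulNr /psC !rmorphN /=.
set c : ps := _%:~R.
have P1 : monom (texp j) * (x (absz (N%:Z - j + 1)%R) * cgauss N (j - 1)) =
          z * x N * (monom (texp (j - 1)) * cgauss N (j - 1)).
  have [h|h] := leqP (absz (j - 1)) N; last by rewrite cgauss0 // !mulr0.
  rewrite !mulrA -!monomD; congr (monom _ * _); have := texpD j.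
  have -> : absz (N%:Z - j + 1)%R = absz (N%:Z - (j - 1))%R by lia.
  have : (absz (N%:Z - (j - 1))%R)%:Z = N%:Z - (j - 1) by lia.
  nia.
have P2 : monom (texp j) * (x (absz (N%:Z + j + 1)%R) * cgauss N (j + 1)) =
          w * x N * (monom (texp (j + 1)) * cgauss N (j + 1)).
  have [h|h] := leqP (absz (j + 1)) N; last by rewrite cgauss0 // !mulr0.
  rewrite !mulrA -!monomD; congr (monom _ * _); have := texpD (j + 1); rewrite addrK.
  have : (absz (N%:Z + j + 1)%R)%:Z = N%:Z + j + 1 by lia.
  have : (M - s)%N%:Z = M%:Z - s%:Z by lia.
  nia.
transitivity (c * ((1 + x ((2 * N).+1)) * (monom (texp j) * cgauss N j)
  + monom (texp j) * (x (absz (N%:Z - j + 1)%R) * cgauss N (j - 1))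
  + monom (texp j) * (x (absz (N%:Z + j + 1)%R) * cgauss N (j + 1)))); first by ring.
by rewrite P1 P2; ring.
Qed.

Lemma gsum_lin B N (u v : int -> int) (a b : int) :
  gsum B N (fun j => a * u j + b * v j) = psC a * gsum B N u + psC b * gsum B N v.
Proof.
rewrite /gsum -!tsumZ -tsumD; apply: eq_tsum => j _.
by rewrite /psC !rmorphM rmorphD !rmorphM /=; ring.
Qed.

Definition qfac j : ps := bin (s + M * j) * bin (M - s + M * j).

Lemma qfacE j : qfac j = 1 + x ((2 * j).+1) - z * x j - w * x j.
Proof.
rewrite /qfac /bin !monomD.
have -> : x ((2 * j).+1) = z * w * (x j * x j).
  by rewrite -!monomD; congr monom; rewrite subnKC //; nia.
ring.
Qed.

Lemma gsum_prod B N : (N <= B)%N ->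
  gsum B N (fun=> 1) = \prod_(0 <= j < N) qfac j.
Proof.
elim: N => [|N IHN] leNB.
  rewrite big_geq // /gsum /tsum.
  have ltB : (B < (2 * B).+1)%N by lia.
  rewrite (bigD1 (Ordinal ltB)) //= subrr /psC expr0 !mul1r big1 ?addr0.
    by rewrite mulr1 (_ : texp 0 = 0%N) ?monom0 // /texp !mulr0 addr0.
  move=> k; rewrite -val_eqE /= => kB; rewrite (_ : (k%:Z - B%:Z == 0) = false) ?mulr0 //.
  by apply/negbTE/eqP; lia.
rewrite gsumS // big_nat_recr //= -IHN; last by lia.
by rewrite qfacE; ring.
Qed.

(** For the weight j the recurrence is that of a derivative: one step multiplies
    the sum by the new factor and adds (w - z) x^N times the unweighted product,
    as in the product rule. *)
Lemma gsum_id B N : (N <= B)%N ->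
  gsum B N id = \sum_(0 <= i < N)
    (w - z) * x i * \prod_(0 <= j < N | j != i) qfac j.
Proof.
elim: N => [|N IHN] leNB.
  rewrite big_geq // /gsum /tsum big1 // => k _.
  have [->|h] := eqVneq (k%:Z - B%:Z) 0; first by rewrite mulr0 /psC mul0r.
  by rewrite /= (negbTE h) !mulr0.
rewrite gsumS // (_ : (fun j : int => id (j + 1)) = fun j => 1 * id j + 1 * (fun=> 1) j).
  rewrite (_ : (fun j : int => id (j - 1)) = fun j => 1 * id j + (-1) * (fun=> 1) j).
    rewrite !gsum_lin gsum_prod; last by lia.
    rewrite [RHS]big_nat_recr //=.
    have -> : \prod_(0 <= j < N.+1 | j != N) qfac j = \prod_(0 <= j < N) qfac j.
      rewrite big_mkcond big_nat_recr //= eqxx mulr1.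
      by apply: eq_big_nat => j /andP[_ lt]; rewrite ltn_eqF.
    have -> : \sum_(0 <= i < N) (w - z) * x i * \prod_(0 <= j < N.+1 | j != i) qfac j
      = qfac N * gsum B N id.
      rewrite IHN; last by lia.
      rewrite mulr_sumr; apply: eq_big_nat => i /andP[_ lt].
      rewrite big_mkcond big_nat_recr //= -big_mkcond /= gtn_eqF //=.
      ring.
    by rewrite qfacE /psC rmorphN !rmorph1; ring.
  by apply/funext => j /=; lia.
by apply/funext => j /=; lia.
Qed.

(** The finite identities have a limit: the coefficient of q^n only sees the
    indices j with |j| <= 2n + 1, whose Gaussian binomials are congruent to
    1 / (x; x)_oo. *)
Lemma theta_lim u n : exists2 N, (n < N)%N &
  eqm n (gser (texp2 M s) (fun j => (-1) ^+ absz j * u j)) (eulerM * gsum N N u).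
Proof.
pose N := (3 * n + 3)%N; exists N; first by rewrite /N; lia.
move=> m ltmn.
rewrite (@gserE _ _ _ _ [seq k%:Z - N%:Z | k <- iota 0 (2 * N).+1]); first last.
- move=> j; rewrite texp2E => h; apply/mapP; exists (absz (j + N%:Z)%R).
    by rewrite mem_iota; have := texp_ge j; rewrite /N; lia.
  by have := texp_ge j; rewrite /N; lia.
- by rewrite map_inj_uniq ?iota_uniq // => a b; lia.
rewrite big_map -[iota 0 _]/(index_iota 0 (2 * N).+1) big_mkord big_mkcond.
rewrite /gsum -tsumZ /tsum pssumE; apply: eq_bigr => k _.
set j := _ - _; rewrite mulrCA psCE mulrCA monommE texp2E.
case: leqP => [le|lt]; last by rewrite mulr0 ifF //; apply/negbTE/eqP; lia.
have cond : (absz j + n.+1 <= N)%N. have := texp_ge j; rewrite /N. lia.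
rewrite (cgauss_lim M0 cond); last by lia.
rewrite ps1E; case: eqP => h; case: eqP => h'; rewrite ?mulr1 ?mulr0 //; lia.
Qed.

End TripleProduct.

(** Jacobi's triple product identity, as the limit of [gsum_prod]. *)
Theorem jacobi_triple_product M s : (0 < s)%N -> (s < M)%N ->
  gser (texp2 M s) (fun j => (-1) ^+ absz j) =
  euler (fun n => (M %| n) + (n %% M == s) + (n %% M == M - s))%N.
Proof.
move=> s0 ltsM; have M0 : (0 < M)%N by lia.
have sM := ltnW ltsM; rewrite !eulerD -/(eulerM M) -mulrA.
have -> : euler (fun n => (n %% M == s)%N : nat) *
          euler (fun n => (n %% M == M - s)%N : nat) = iprod (qfac M s).
  have := @euler_prog M M0 s; rewrite s0 sM => /(_ isT); rewrite modn_small // => <-.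
  have := @euler_prog M M0 (M - s); rewrite (_ : (0 < M - s <= M)%N); last by lia.
  move/(_ isT); rewrite modn_small; last by lia.
  by move=> <-; rewrite -iprodM // => j; apply: eqmW (@bin_eqm _); nia.
apply/funext => n; have [N ltnN] := theta_lim M0 s0 sM (fun=> 1) n.+1.
rewrite (@gser_ext _ _ _ (texp2 M s) (fun j => (-1) ^+ absz j)) //; last first.
  by move=> j; rewrite mulr1.
move=> ->//; rewrite gsum_prod // big_mkord.
apply: (@eqmM N) => //; last by lia.
apply/eqm_sym/iprod_eqm.
by apply: cvgprodM => j; apply: eqmW (@bin_eqm _); nia.
Qed.

Lemma qfac_diag M : qfac M M 0 = 0.
Proof. by rewrite /qfac subnn muln0 /bin monom0 subrr mulr0. Qed.

Lemma theta_diag0 M : (0 < M)%N ->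
  gser (texp2 M M) (fun j => (-1) ^+ absz j) = 0.
Proof.
move=> M0; apply/funext => n.
have [N ltnN] := theta_lim M0 M0 (leqnn M) (fun=> 1) n.+1.
rewrite (@gser_ext _ _ _ (texp2 M M) (fun j => (-1) ^+ absz j)) //; last first.
  by move=> j; rewrite mulr1.
move=> ->//; rewrite gsum_prod // (big_ltn (_ : 0 < N)%N); last by lia.
by rewrite qfac_diag mul0r mulr0.
Qed.

(** When s = M the first factor of the product vanishes. Only the summand of
    [gsum_id] that leaves it out survives, and its limit is a cube. *)
Lemma jacobi_cube M : (0 < M)%N ->
  gser (texp2 M M) (fun j => (-1) ^+ absz j * j) = eulerM M ^+ 3.
Proof.
move=> M0; apply/funext => n.
have [N ltnN ->] := theta_lim M0 M0 (leqnn M) id n.+1; last by [].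
rewrite gsum_id // (big_ltn (_ : 0 < N)%N); last by lia.
rewrite [X in _ + X]big_nat_cond [X in _ + X]big1 ?addr0; last first.
  move=> i /andP[/andP[i0 _] _]; rewrite big_mkcond (big_ltn (_ : 0 < N)%N); last by lia.
  by rewrite eq_sym -lt0n i0 /= qfac_diag mul0r mulr0.
rewrite muln0 subnn monom0 mulr1.
have -> : \prod_(0 <= j < N | j != 0%N) qfac M M j = \prod_(1 <= j < N) qfac M M j.
  rewrite big_mkcond (big_ltn (_ : 0 < N)%N); last by lia.
  by rewrite /= mul1r; apply: eq_big_nat => j /andP[j0 _]; rewrite -lt0n j0.
have -> : (1 - monom M) * \prod_(1 <= j < N) qfac M M j = qfact M N * qfact M N.-1.
  rewrite /qfact -!(big_mkord xpredT (fun i => bin (M * i.+1))).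
  rewrite [X in _ = X * _](big_ltn (_ : 0 < N)%N); last by lia.
  rewrite -mulrA -/(bin M) muln1; congr (_ * _).
  case: N ltnN => // N _; rewrite big_add1 /= [X in X * _]big_add1 /=.
  rewrite -big_split /=; apply: eq_bigr => j _.
  by rewrite /qfac subnn add0n -mulnS.
rewrite !exprS expr0 mulr1.
apply: (@eqmM n.+1) => //; apply: eqmM; apply: eulerM_eqm => //; lia.
Qed.


(** * The cube of the Euler product *)

(** Up to a global sign e, f = g / (1 - q^d): the coefficients of f have one
    sign, and f(n + d) is f(n) plus a term of the same sign. *)
Definition one_signed f := exists (e : bool) (d : nat) (g : ps),
  [/\ (0 < d)%N, nonneg g & f * bin d = (-1) ^+ e * g].

Lemma one_signed0 : one_signed 0.
Proof. by exists false, 1%N, 0; split=> //; rewrite mul0r mulr0. Qed.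

Lemma one_signed_signs f : one_signed f -> exists (e : bool) (d : nat),
  [/\ (0 < d)%N, forall n, 0 <= (-1) ^+ e * f n &
      forall n, f n != 0 -> f (n + d)%N != 0].
Proof.
move=> [e [d [g [d0 g0 fg]]]]; exists e, d.
have sgnE (h : ps) n : ((-1) ^+ e * h) n = (-1) ^+ e * h n.
  by case: e {fg}; rewrite ?expr1 ?expr0 ?mul1r // !mulN1r psoE.
have rec n : (-1) ^+ e * f (n + d)%N = (-1) ^+ e * f n + g (n + d)%N.
  have := congr1 (fun h : ps => ((-1) ^+ e * h) (n + d)%N) fg.
  rewrite mulrA -expr2 sqrr_sign mul1r => <-; rewrite sgnE binE mulrBr mulr1.
  rewrite psaE psoE [f * _]mulrC monommE leq_addl addnK; ring.
have small n : (n < d)%N -> (-1) ^+ e * f n = g n.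
  move=> nd; have := congr1 (fun h : ps => ((-1) ^+ e * h) n) fg.
  rewrite mulrA -expr2 sqrr_sign mul1r => <-; rewrite sgnE binE mulrBr mulr1.
  by rewrite psaE psoE [f * _]mulrC monommE leqNgt nd subr0.
have pos n : 0 <= (-1) ^+ e * f n.
  elim/ltn_ind: n => n IHn; have [nd|dn] := ltnP n d; first by rewrite small.
  by rewrite -(subnK dn) rec addr_ge0 // IHn //; lia.
split=> // n fn; apply: contra fn => /eqP z.
have := rec n; have := pos n; have := g0 (n + d)%N.
by rewrite z; case: (e); rewrite ?expr1 ?expr0; lia.
Qed.

Lemma phi_eulerM : phi = eulerM 1.
Proof. by apply: euler_ext => n _; rewrite dvd1n. Qed.

Lemma phi3E : phi ^+ 3 = gser (texp2 1 1) (fun j => (-1) ^+ absz j * j).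
Proof. by rewrite phi_eulerM jacobi_cube. Qed.

Lemma phi_exp m : phi ^+ m = euler (fun=> m).
Proof.
elim: m => [|m IHm].
  by rewrite expr0 /euler -[LHS]iprod1; apply: iprod_ext => i; rewrite expr0.
by rewrite exprS IHm -eulerD.
Qed.

Lemma phiI m f g : f * phi ^+ m = g -> f = g * part (fun=> m).
Proof. by rewrite phi_exp => /eulerI. Qed.

Lemma count_prog (l : seq nat) k s M : uniq l -> (0 < M)%N ->
  (count_mem k [seq (s + M * j)%N | j <- l] <= (k %% M == s %% M))%N.
Proof.
move=> ul M0; rewrite count_uniq_mem; last first.
  by rewrite map_inj_uniq // => a b; nia.
case: mapP => // -[j _ ->].
by rewrite mulnC addnC modnMDl eqxx.
Qed.

(** The factors of the triple product at two distinct classes modulo p have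
    distinct degrees, so together with 1 - q and 1 - q^(2s-p) no degree occurs
    more than three times, and the multiples of p are left to [eulerM]. *)
Lemma nonneg_theta_part p s (l : seq nat) : odd p -> (1 < p)%N ->
  (s < p)%N -> (p < 2 * s)%N -> uniq l ->
  nonneg (bin 1 * bin (2 * s - p) * (\prod_(j <- l) qfac p s j) *
          (eulerM p * part (fun=> 3%N))).
Proof.
move=> op p1 sp ps ul.
rewrite /eulerM euler_part; last by move=> n _; case: (p %| n)%N.
pose S := [:: 1; 2 * s - p]%N ++ [seq (s + p * j)%N | j <- l] ++
          [seq (p - s + p * j)%N | j <- l].
have -> : bin 1 * bin (2 * s - p) * (\prod_(j <- l) qfac p s j) = \prod_(k <- S) bin k.
  rewrite /S !big_cat !big_cons big_nil /= !big_map mulr1.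
  by rewrite -big_split.
apply: nonneg_prod_part => k.
  rewrite /S !mem_cat !inE => /or3P[/orP[]/eqP->|/mapP[j _ ->]|/mapP[j _ ->]]; lia.
rewrite /S !count_cat /= addn0.
have p0 : (0 < p)%N by lia.
have c1 := count_prog k s ul p0; have c2 := count_prog k (p - s) ul p0.
rewrite (modn_small sp) in c1; rewrite (@modn_small (p - s)) in c2; last by lia.
case: (boolP (p %| k)%N) => pk.
  have k1 : (1 == k)%N = false by apply/negbTE/eqP => E; rewrite -E dvdn1 in pk; lia.
  have k2 : (2 * s - p == k)%N = false.
    by apply/negbTE/eqP => E; move: pk; rewrite -E gtnNdvd //; lia.
  rewrite k1 k2; move: pk; rewrite /dvdn => /eqP pk; rewrite pk in c1 c2.
  have e1 : (0 == s)%N = false by apply/negbTE/eqP; lia.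
  have e2 : (0 == p - s)%N = false by apply/negbTE/eqP; lia.
  rewrite e1 in c1; rewrite e2 in c2; move: c1 c2.
  by rewrite /= !leqn0 => /eqP-> /eqP->.
have c12 : ((k %% p == s) + (k %% p == p - s) <= 1)%N.
  have [ks|ks] := eqVneq (k %% p)%N s; last by case: (_ == _).
  suff -> : (k %% p == p - s)%N = false by [].
  apply/negbTE/eqP; rewrite ks => E; have pE : p = (2 * s)%N by lia.
  by rewrite pE oddM in op.
have := leq_b1 (1 == k)%N; have := leq_b1 (2 * s - p == k)%N.
move: (count_mem k _) (count_mem k _) c1 c2 => x y c1 c2.
rewrite subn0; lia.
Qed.

(** The weighted theta series divided by (q; q)_oo^3. The contribution of the
    linear weight is a sum of partial products with one factor of index i left
    out, times w - z = w (1 - q^(2s-p)); the factor 1 - q^(2s-p) is cancelled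
    as well. *)
Lemma nonneg_theta_weighted p s (a b : nat) : odd p -> (1 < p)%N ->
  (s < p)%N -> (p < 2 * s)%N ->
  nonneg (bin 1 * gser (texp2 p s) (fun j => (-1) ^+ absz j * (a%:Z * j + b%:Z))
          * part (fun=> 3%N)).
Proof.
move=> op p1 sp ps n; have p0 : (0 < p)%N by lia.
have s0 : (0 < s)%N by lia.
have sp' := ltnW sp.
have [N _ E] := theta_lim p0 s0 sp' (fun j => a%:Z * j + b%:Z) n.+1.
have -> : (bin 1 * gser (texp2 p s) (fun j => (-1) ^+ absz j * (a%:Z * j + b%:Z))
          * part (fun=> 3%N)) n =
    (bin 1 * (eulerM p * gsum p s N N (fun j => a%:Z * j + b%:Z)) * part (fun=> 3%N)) n.
  by apply: (@eqmM n.+1) => //; apply: eqmM.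
rewrite (_ : (fun j => _) = (fun j : int => a%:Z * id j + b%:Z * (fun=> 1) j)); last first.
  by apply/funext => j /=; rewrite mulr1.
rewrite (gsum_lin p s N N id (fun=> 1)) gsum_prod // gsum_id //.
have bs : monom (p - s) - monom s = monom (p - s) * bin (2 * s - p).
  by rewrite binE mulrBr mulr1 -monomD; congr (_ - monom _); lia.
have psCn c : psC c%:Z = c%:R by rewrite /psC -pmulrn.
rewrite !psCn; set D := \sum_(0 <= i < N) _; set S := \prod_(0 <= j < N) _.
have Ks : bin (2 * s - p) * geo (2 * s - p) = 1 by apply: geoK; lia.
pose G l := bin 1 * bin (2 * s - p) * (\prod_(j <- l) qfac p s j) *
            (eulerM p * part (fun=> 3%N)).
have G0 l : uniq l -> nonneg (G l) by move=> ul; apply: nonneg_theta_part.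
have -> : bin 1 * (eulerM p * (a%:R * D + b%:R * S)) * part (fun=> 3%N) =
    a%:R * (bin 1 * D * (eulerM p * part (fun=> 3%N))) +
    b%:R * (bin 1 * S * (eulerM p * part (fun=> 3%N))) by ring.
rewrite !mulr_natl; apply: nonnegD; apply: nonnegMn.
  have -> : bin 1 * D * (eulerM p * part (fun=> 3%N)) =
      \sum_(0 <= i < N) monom (p * i) * (monom (p - s) * G [seq j <- index_iota 0 N | j != i]).
    rewrite /D mulr_sumr mulr_suml; apply: eq_bigr => i _.
    by rewrite /G big_filter bs; ring.
  apply: nonneg_sum => i _; apply: nonnegM; first exact: nonneg_monom.
  apply: nonnegM; first exact: nonneg_monom.
  by apply: G0; rewrite filter_uniq // iota_uniq.
have -> : bin 1 * S * (eulerM p * part (fun=> 3%N)) =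
          geo (2 * s - p) * G (index_iota 0 N).
  by rewrite /G -/S -[LHS]mul1r -Ks; ring.
by apply: nonnegM; [exact: nonneg_geo | apply/G0/iota_uniq].
Qed.

Lemma gser_bool (T : choiceType) (e : T -> int) (u : bool * T -> int) : coercive e ->
  gser (fun x : bool * T => e x.2) u = gser e (fun i => u (true, i) + u (false, i)).
Proof.
move=> ce; apply/funext => n; have [s [us sE]] := coercive_seq (2 * n)%:Z ce.
rewrite (@gserE _ e _ _ s) //; last by move=> i ei; rewrite sE ei.
rewrite (@gserE _ _ _ _ [seq (b, i) | b <- [:: true; false], i <- s]).
- rewrite big_mkcond big_allpairs big_cons big_seq1 /=.
  rewrite -big_split [RHS]big_mkcond /=.
  by apply: eq_bigr => i _ /=; case: eqP; rewrite ?addr0.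
- by apply: allpairs_uniq => // -[? ?] [? ?] _ _ [-> ->].
- move=> [b i] /= ei; have si : i \in s by rewrite sE ei.
  by rewrite cats0 mem_cat; case: b; apply/orP; [left | right]; apply: map_f.
Qed.

Lemma gser_lin (T : choiceType) (e u v : T -> int) (a b : int) : coercive e ->
  gser e (fun i => a * u i + b * v i) = psC a * gser e u + psC b * gser e v.
Proof.
move=> ce; apply/funext => n; have [s [us sE]] := coercive_seq (2 * n)%:Z ce.
rewrite psaE !psCE !(@gserE _ e _ _ s) //; try by move=> i ei; rewrite sE ei.
by rewrite big_split !mulr_sumr.
Qed.

Lemma signrD_absz p (k i : int) : odd p ->
  (-1) ^+ absz (p%:Z * i + k) = (-1) ^+ odd (absz k) * (-1) ^+ absz i :> int.
Proof.
move=> op; rewrite signr_odd -exprD -[LHS]signr_odd -[RHS]signr_odd.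
congr (_ ^+ nat_of_bool _); rewrite oddD.
have -> : odd (absz (p%:Z * i + k)) = odd (absz (p%:Z * i)) (+) odd (absz k) by lia.
by rewrite abszM oddM op addbC.
Qed.

(** The indices j of the section with j(j+1)/2 = r modulo p are those with
    2j + 1 = 2s modulo p or 2j + 1 = -2s modulo p, where s can be chosen in
    the upper half of the residues. The two classes are exchanged by
    j -> -1 - j, which preserves the exponent. *)
Lemma sect_phi3 p r : prime p -> odd p -> (r < p)%N ->
  one_signed (sect p r (cseq p 3)).
Proof.
move=> pp op rp; have p1 := prime_gt1 pp; have p0 := prime_gt0 pp.
have := sect_cseq 3 rp; rewrite [X in _ = sect p r X]phi3E; set f := sect p r _.
set e' := texp2 1 1; set u' := fun j : int => _.
have e'E j : e' j = j * (j + 1) by rewrite /e' /texp2; ring.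
have [[j0 [n0 E0]]|none] := pselect (exists j n, e' j = (2 * (p * n + r))%:Z); last first.
  rewrite (sect_gser0 u' none) => /phiI; rewrite mul0r => ->; exact: one_signed0.
have [q pE] : exists q, p = (2 * q).+1 by exists p./2; lia.
(* k is the least nonnegative member of the two classes *)
have [k [i0 [kq Ek]]] : exists k i1, (k <= q)%N /\ e' (p%:Z * i1 + k%:Z) = (2 * (p * n0 + r))%:Z.
  have jE := divz_eq j0 p%:Z; set m := (j0 %% p%:Z)%Z in jE.
  have m0 : 0 <= m by apply: modz_ge0; lia.
  have mp : m < p%:Z by apply: ltz_pmod; lia.
  have [h|h] := leP m q%:Z.
    exists (absz m), (j0 %/ p%:Z)%Z; split; first by lia.
    by rewrite -E0; congr e'; lia.
  exists (absz (p%:Z - 1 - m)%R), (- 1 - (j0 %/ p%:Z)%Z); split; first by lia.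
  set d := (j0 %/ p%:Z)%Z in jE *.
  have -> : p%:Z * (- 1 - d) + (absz (p%:Z - 1 - m)%R)%:Z = - 1 - j0 by lia.
  by rewrite -E0 !e'E; ring.
have classes j n : e' j = (2 * (p * n + r))%:Z -> exists i,
    p%:Z * i + k%:Z = j \/ - 1 - (p%:Z * i + k%:Z) = j.
  set h0 := _ + k%:Z in Ek; move=> Ej.
  have : (p%:Z %| (j - h0) * (j + h0 + 1))%Z.
    apply/dvdzP; exists (2 * (n%:Z - n0%:Z)).
    have -> : (j - h0) * (j + h0 + 1) = e' j - e' h0 by rewrite !e'E; ring.
    by rewrite Ej Ek; lia.
  rewrite dvdzE abszM Euclid_dvdM // => /orP[]; rewrite -dvdzE => /dvdzP[d dE].
    by exists (d + i0); left; rewrite /h0 in dE; lia.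
  by exists (i0 - d); right; rewrite /h0 in dE *; lia.
pose s := (k + q.+1)%N; pose sg : bool := odd k.
have s0 : (0 < s)%N by rewrite /s addnS.
have sp : (s <= p)%N by rewrite /s; lia.
have k0 : 0 <= k%:Z * (k%:Z + 1) by [].
have eh i : e' (p%:Z * i + k%:Z) = p%:Z * texp2 p s i + k%:Z * (k%:Z + 1).
  rewrite e'E /texp2 (_ : (2 * s)%:Z = 2 * k%:Z + p%:Z + 1); last by rewrite /s; lia.
  ring.
have sgE i : (-1) ^+ absz (p%:Z * i + k%:Z) = (-1) ^+ sg * (-1) ^+ absz i :> int.
  exact: signrD_absz.
(* For k = q the two classes coincide. *)
have [kq'|kq'] := eqVneq k q.
- have sE : s = p by rewrite /s; lia.
  pose u i := (-1) ^+ sg * (p%:Z * ((-1) ^+ absz i * i) + k%:Z * (-1) ^+ absz i) : int.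
  pose h i := p%:Z * i + k%:Z.
  have hinj : injective h by move=> a b; rewrite /h; nia.
  have uh i : u' (h i) = u i by rewrite /u' /u sgE /h; ring.
  have surj j n : e' j = (2 * (p * n + r))%:Z -> exists i, h i = j.
    move=> /classes[i [<-|<-]]; first by exists i.
    by exists (- i - 1); rewrite /h; lia.
  have [C ->] := sect_gser rp hinj (evenly_texp2 p0 s0 sp) k0 eh uh surj Ek.
  rewrite gser_scale gser_lin; last exact: coercive_texp2.
  rewrite sE jacobi_cube // theta_diag0 // mulr0 addr0 => /phiI ->.
  have E3 : eulerM p ^+ 3 = euler (fun n => (p %| n) + ((p %| n) + (p %| n)))%N.
    by rewrite !eulerD !exprS expr0 mulr1.
  exists sg, 1%N, ((monom C * (euler (fun n => ((p %| n) + ((p %| n) + (p %| n))) + (n == 1))%N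
     * part (fun=> 3%N))) *+ p); split=> //.
    apply: nonnegMn; apply: nonnegM; first exact: nonneg_monom.
    rewrite euler_part; first exact: nonneg_part.
    move=> n _; have [->|_] := eqVneq n 1%N; last by case: (p %| n)%N.
    by rewrite dvdn1; have -> : (p == 1)%N = false by apply/eqP; lia.
  rewrite eulerD -E3 euler1 // /psC -pmulrn -mulr_natl; ring.
have sp' : (s < p)%N by rewrite /s; lia.
pose h (x : bool * int) := if x.1 then p%:Z * x.2 + k%:Z else - 1 - (p%:Z * x.2 + k%:Z).
pose e (x : bool * int) := texp2 p s x.2.
have hinj : injective h.
  have pI a b : p%:Z * a = p%:Z * b -> a = b by apply: mulfI; lia.
  have off a b : p%:Z * a + k%:Z <> - 1 - (p%:Z * b + k%:Z).
    move=> ab; have : p%:Z * (a + b) = - (2 * k + 1)%:Z by lia.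
    have [t0|t0] := lerP 0 (a + b).
      by have := mulr_ge0 (isT : 0 <= p%:Z) t0; lia.
    have : p%:Z * (a + b) <= p%:Z * (- 1) by apply: ler_wpM2l => //; lia.
    by lia.
  move=> [[] a] [[] b]; rewrite /h /= => ab.
  - by congr (_, _); apply: pI; lia.
  - by case: (off a b).
  - by case: (off b a).
  - by congr (_, _); apply: pI; lia.
have ee : evenly e by move=> [b i]; exact: evenly_texp2.
have eh' x : e' (h x) = p%:Z * e x + k%:Z * (k%:Z + 1).
  case: x => [[] i]; rewrite /h /e /=; first exact: eh.
  by rewrite -eh !e'E; ring.
have surj j n : e' j = (2 * (p * n + r))%:Z -> exists x, h x = j.
  by move=> /classes[i [<-|<-]]; [exists (true, i) | exists (false, i)].
have [C ->] := @sect_gser _ _ p r e (u' \o h) e' u' h _ (true, i0) n0 rp hinj ee k0 eh'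
  (fun=> erefl) surj Ek.
rewrite (@gser_bool _ (texp2 p s)); last exact: coercive_texp2.
rewrite (@gser_ext _ _ _ (texp2 p s) (fun i => (-1) ^+ sg *
  ((-1) ^+ absz i * ((2 * p)%:Z * i + (2 * k + 1)%:Z)))) //=; last first.
  move=> i; rewrite /h /u' /=; set x := _ + k%:Z.
  have -> : (-1) ^+ absz (- 1 - x)%R = - (-1) ^+ absz x :> int by apply: signr_flip; lia.
  by rewrite /x sgE; ring.
rewrite gser_scale => /phiI ->.
exists sg, 1%N, (monom C * (bin 1 * gser (texp2 p s) (fun i =>
  (-1) ^+ absz i * ((2 * p)%:Z * i + (2 * k + 1)%:Z)) * part (fun=> 3%N))); split=> //.
  apply: nonnegM; first exact: nonneg_monom.
  by apply: nonneg_theta_weighted => //; rewrite /s; lia.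
ring.
Qed.

(** * The first power of the Euler product *)

(** The pentagonal number theorem, with the exponents y(3y - 1)/2 for a = 1 and
    y(3y + 1)/2 for a = 2. Taking one or the other according to p modulo 6
    makes the same parametrization of the classes modulo p work for all p. *)
Lemma phi1E a : (a == 1) || (a == 2) ->
  phi = gser (texp2 3 a) (fun j => (-1) ^+ absz j).
Proof.
move=> aE; have a0 : (0 < a)%N by case/orP: aE => /eqP->.
have a3 : (a < 3)%N by case/orP: aE => /eqP->.
rewrite (jacobi_triple_product a0 a3); apply: euler_ext => n _.
have n3 : (n %% 3 < 3)%N by rewrite ltn_mod.
rewrite /dvdn; move: (n %% 3)%N n3 => c.
by case/orP: aE => /eqP->; case: c => [|[|[|c]]].
Qed.


(** The doubled exponents of the two classes of indices that make up a
    section. *)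
Definition quin (p s : nat) (x : bool * int) : int :=
  let k := x.2 in
  if x.1 then p%:Z * (3 * k ^+ 2 - k) + 6 * s%:Z * k
  else p%:Z * (3 * k ^+ 2 + k) + 2 * s%:Z * (3 * k + 1).

(** Both quadratic forms are sums, with coefficients s and p - 2s, of quadratic
    polynomials that are nonnegative at the integers. *)
Lemma quin_ge p s x : (0 < p)%N -> (2 * s <= p)%N ->
   (absz x.2)%:Z <= quin p s x + 1 /\ 0 <= quin p s x.
Proof.
move=> p0 sp; have [t pE] : exists t, p = (2 * s + t)%N by exists (p - 2 * s)%N; lia.
case: x => [b k]; rewrite /quin /= pE.
have -> : (2 * s + t)%N%:Z = 2 * s%:Z + t%:Z by lia.
have s0 : 0 <= s%:Z by []. have t0 : 0 <= t%:Z by [].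
have tp : 0 < s%:Z + t%:Z by lia.
move: (s%:Z) (t%:Z) s0 t0 tp => S T S0 T0 ST.
case: b.
  have -> : (2 * S + T) * (3 * k ^+ 2 - k) + 6 * S * k =
            S * (6 * k ^+ 2 + 4 * k) + T * (3 * k ^+ 2 - k) by ring.
  have [k0|k0] := eqVneq k 0; first by rewrite k0; lia.
  have h1 : (absz k)%:Z <= 6 * k ^+ 2 + 4 * k by nia.
  have h2 : (absz k)%:Z <= 3 * k ^+ 2 - k by nia.
  have := ler_wpM2l S0 h1; have := ler_wpM2l T0 h2; nia.
have -> : (2 * S + T) * (3 * k ^+ 2 + k) + 2 * S * (3 * k + 1) =
          S * (6 * k ^+ 2 + 8 * k + 2) + T * (3 * k ^+ 2 + k) by ring.
have [k0|k0] := eqVneq k 0; first by rewrite k0; lia.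
have [k1|k1] := eqVneq k (-1).
  rewrite k1.
  have -> : 6 * (-1) ^+ 2 + 8 * -1 + 2 = 0 :> int by [].
  lia.
have h1 : (absz k)%:Z <= 6 * k ^+ 2 + 8 * k + 2 by nia.
have h2 : (absz k)%:Z <= 3 * k ^+ 2 + k by nia.
have := ler_wpM2l S0 h1; have := ler_wpM2l T0 h2; nia.
Qed.

Lemma evenly_quin p s : (0 < p)%N -> (2 * s <= p)%N -> evenly (quin p s).
Proof.
move=> p0 sp x; have [_ x0] := quin_ge x p0 sp.
have [t tE] : exists t, quin p s x = 2 * t.
  case: {x0} x => [[] k]; rewrite /quin /=.
    exists (p%:Z * ((tri k)%:Z + k ^+ 2) + 3 * s%:Z * k); have := triE k; nia.
  exists (p%:Z * (k ^+ 2 + (tri (k + 1))%:Z) + s%:Z * (3 * k + 1)).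
  have := triE (k + 1); nia.
by exists (absz t); lia.
Qed.

Lemma coercive_quin p s : (0 < p)%N -> (2 * s <= p)%N -> coercive (quin p s).
Proof.
by move=> p0 sp; apply: coercive_bool => b i; have [] := quin_ge (b, i) p0 sp.
Qed.

Definition quinw (x : bool * int) : int := (-1) ^+ absz x.2.

(** The quintuple product identity in the form H(s) theta(s) = (q^p; q^p)_oo
    theta(2s), where H(s) is the series of [quin p s]. The term of H(s) with
    index k and the term of theta(s) with index m have total degree N in s,
    where N = 3k + m in the first class and N = 3k + 1 + m in the second one.
    For odd N the two classes cancel each other; for N = 2h the indices
    r = 2k - h and r = h - 2k - 1 exhaust those of the pentagonal series that
    are congruent to h modulo 2 and those that are not. *)
Lemma quintuple_product p s : (0 < s)%N -> (2 * s < p)%N ->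
  gser (quin p s) quinw * gser (texp2 p s) (fun j => (-1) ^+ absz j) =
  gser (texp2 (3 * p) (2 * p)) (fun j => (-1) ^+ absz j) *
  gser (texp2 p (2 * s)) (fun j => (-1) ^+ absz j).
Proof.
move=> s0 sp; have p0 : (0 < p)%N by lia.
have p30 : (0 < 3 * p)%N by lia. have p20 : (0 < 2 * p)%N by lia.
have s20 : (0 < 2 * s)%N by lia. have p23 : (2 * p <= 3 * p)%N by lia.
have sp1 : (s <= p)%N by lia. have sp2 := ltnW sp.
have eq1 := evenly_quin p0 sp2. have cq1 := coercive_quin p0 sp2.
have et1 := evenly_texp2 p0 s0 sp1. have ct1 := coercive_texp2 p0 s0 sp1.
rewrite !gserM //; try by [exact: evenly_texp2 | exact: coercive_texp2].
pose N (x : bool * int * int) := 3 * x.1.2 + x.2 + (if x.1.1 then 0 else 1).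
pose keep x := ~~ odd (absz (N x)).
pose half x := (N x %/ 2)%Z.
pose h x := if x.1.1 then (2 * x.1.2 - half x, half x)
            else (half x - 2 * x.1.2 - 1, half x).
pose flip x := let k := half x - x.1.2 in
  ((~~ x.1.1, k), if x.1.1 then N x - 1 - 3 * k else N x - 3 * k).
have keepE x : keep x -> N x = 2 * half x by rewrite /keep /half; lia.
have oddE x : ~~ keep x -> N x = 2 * half x + 1 by rewrite /keep /half; lia.
apply: (@gser_cancel _ _ _ _ _ _ keep h flip).
- exact: coercive_pair.
- move=> x kx; have Nx := oddE x kx.
  have NF : N (flip x) = N x.
    by move: Nx; rewrite /flip /N; case: x {kx} => [[[] k] m] /=; lia.
  have hF : half (flip x) = half x by rewrite /half NF.
  split.
  + by rewrite /keep NF.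
  + rewrite {1}/flip NF hF; move: Nx; rewrite /flip; set c := half x; rewrite /N.
    case: x {kx NF hF} @c => [[[] k] m] c /= Nx; congr (_, _, _); lia.
  + move: Nx; rewrite /flip; set c := half x; rewrite /N /quin /texp2.
    case: x {kx NF hF} @c => [[[] k] m] c /= Nx.
      have -> : m = 2 * c + 1 - 3 * k by lia.
      ring.
    have -> : m = 2 * c - 3 * k by lia.
    ring.
  + move: Nx; rewrite /flip; set c := half x; rewrite /N /quinw.
    case: x {kx NF hF} @c => [[[] k] m] c /= Nx; rewrite -!exprD; apply: signr_flip; rewrite !oddD; lia.
- move=> x kx; have Nx := keepE x kx; rewrite /h; set c := half x in Nx *.
  move: Nx; rewrite /N /quin /quinw /texp2.
  case: x {kx} @c => [[[] k] m] c /= Nx; split.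
  + have -> : m = 2 * c - 3 * k by lia.
    rewrite (_ : (3 * p)%:Z = 3 * p%:Z) // (_ : (2 * (2 * p))%:Z = 4 * p%:Z); last by lia.
    rewrite (_ : (2 * (2 * s))%:Z = 4 * s%:Z); last by lia.
    rewrite (_ : (2 * s)%:Z = 2 * s%:Z); last by lia.
    ring.
  + rewrite -!exprD -signr_odd -[RHS]signr_odd; congr (_ ^+ nat_of_bool _).
    by rewrite !oddD; lia.
  + have -> : m = 2 * c - 1 - 3 * k by lia.
    rewrite (_ : (3 * p)%:Z = 3 * p%:Z) // (_ : (2 * (2 * p))%:Z = 4 * p%:Z); last by lia.
    rewrite (_ : (2 * (2 * s))%:Z = 4 * s%:Z); last by lia.
    rewrite (_ : (2 * s)%:Z = 2 * s%:Z); last by lia.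
    ring.
  + rewrite -!exprD -signr_odd -[RHS]signr_odd; congr (_ ^+ nat_of_bool _).
    by rewrite !oddD; lia.
- move=> x y kx ky; have Nx := keepE x kx; have Ny := keepE y ky.
  rewrite /h; move: Nx Ny; set c := half x; set d := half y; rewrite /N.
  case: x {kx} @c => [[[] k] m] c /=; case: y {ky} @d => [[[] k'] m'] d /= Nx Ny [E1 E2].
  + by congr (_, _, _); lia.
  + by exfalso; lia.
  + by exfalso; lia.
  + by congr (_, _, _); lia.
- move=> [r c].
  have [o|o] := boolP (odd (absz (c + r))).
    pose k := ((c - r - 1) %/ 2)%Z.
    have kE : c - r - 1 = 2 * k by rewrite /k; lia.
    exists (false, k, 2 * c - 1 - 3 * k); first by rewrite /keep /N /=; lia.
    by rewrite /h /half /N /=; congr (_, _); lia.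
  pose k := ((c + r) %/ 2)%Z.
  have kE : c + r = 2 * k by rewrite /k; lia.
  exists (true, k, 2 * c - 3 * k); first by rewrite /keep /N /=; lia.
  by rewrite /h /half /N /=; congr (_, _); lia.
Qed.

Lemma euler_prog3 p : (0 < p)%N ->
  euler (fun n => (3 * p %| n) + (n %% (3 * p) == 2 * p) +
                  (n %% (3 * p) == 3 * p - 2 * p))%N =
  euler (fun n => (p %| n)%N : nat).
Proof.
move=> p0; apply: euler_ext => n _.
have -> : (3 * p - 2 * p = p)%N by lia.
have [/dvdnP[q ->]|pn] := boolP (p %| n)%N.
  rewrite dvdn_pmul2r // -muln_modl eqn_pmul2r //.
  rewrite (_ : (_ * p == p)%N = (q %% 3 == 1)%N); last first.
    by rewrite -{2}(mul1n p) eqn_pmul2r.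
  rewrite /dvdn; have : (q %% 3 < 3)%N by rewrite ltn_mod.
  by case: (q %% 3)%N => [|[|[|]]].
have H j : (n %% (3 * p) == j * p)%N = false.
  apply/negbTE/eqP => E; move/negP: pn; apply.
  by rewrite (divn_eq n (3 * p)) E mulnA -mulnDl dvdn_mull.
have := H 0%N; have := H 1%N; rewrite mul0n mul1n => H1 H0.
by rewrite /dvdn H0 H1 (H 2%N).
Qed.

(** In the quotient of the quintuple product by phi every factor 1 - q^n has an
    exponent at most 0, and that of 1 - q^s is negative, which leaves room for
    the factor [bin s]. *)
Lemma nonneg_quin_part p s : (0 < s)%N -> (2 * s < p)%N -> odd p ->
  nonneg (gser (quin p s) quinw * part (fun=> 1%N) * bin s).
Proof.
move=> s0 sp op; have p0 : (0 < p)%N by lia.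
have ltsp : (s < p)%N by lia.
have p30 : (0 < 3 * p)%N by lia. have p20 : (0 < 2 * p)%N by lia.
have s20 : (0 < 2 * s)%N by lia.
have := quintuple_product s0 sp.
rewrite (jacobi_triple_product s0 ltsp).
rewrite (jacobi_triple_product s20 sp).
rewrite (@jacobi_triple_product (3 * p) (2 * p)) //; try lia.
rewrite euler_prog3 //.
set a := fun n => _; set b := fun n => _; set c := fun n => _ => /eulerI ->.
have -> : euler b * euler c * part a * part (fun=> 1%N) * bin s
    = euler (fun n => (p %| n) + c n + (n == s))%N * part (fun n => a n + 1)%N.
  by rewrite !eulerD partD euler1 //; ring.
rewrite euler_part; first exact: nonneg_part.
move=> n _; rewrite /a /b /c /dvdn.
have [/eqP pn|pn] := boolP (n %% p == 0)%N.
  rewrite pn.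
  have -> : (n == s) = false.
    by apply/negbTE/eqP => ns; rewrite ns modn_small in pn; lia.
  have -> : (0 == 2 * s)%N = false by apply/negbTE/eqP; lia.
  have -> : (0 == p - 2 * s)%N = false by apply/negbTE/eqP; lia.
  by rewrite !addn0; case: (0 == s)%N; case: (0 == p - s)%N.
have c1 : ((n %% p == 2 * s) + (n %% p == p - 2 * s) <= 1)%N.
  have [ns|ns] := eqVneq (n %% p)%N (2 * s)%N; last by case: (_ == _).
  suff -> : (n %% p == p - 2 * s)%N = false by [].
  by apply/negbTE/eqP; rewrite ns; lia.
have c2 : ((n == s) <= (n %% p == s))%N.
  by have [->|_] //= := eqVneq n s; rewrite modn_small // eqxx.
rewrite /=; move: c1 c2.
by move: (n %% p == 2 * s)%N (n %% p == p - 2 * s)%N (n == s) (n %% p == s)%N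
  (n %% p == p - s)%N => [] [] [] [] [].
Qed.

(** The two classes of indices of a section, for p = 6v + 1 or p = 6v - 1: in
    the coordinates of [phi1E] with a = 1 or a = 2 respectively, 6y - (3 - 2a)
    is congruent to 6s or to - 6s modulo p. *)
Lemma sect_phi1 p r a v : prime p -> odd p -> (3 < p)%N -> (r < p)%N ->
  (a == 1) || (a == 2) -> (p + 2 * a = 6 * v + 3)%N ->
  one_signed (sect p r (cseq p 1)).
Proof.
move=> pp op p3 rp aE pE; have p1 := prime_gt1 pp; have p0 := prime_gt0 pp.
have := sect_cseq 1 rp; rewrite [X in _ = sect p r X]expr1 [X in _ = sect p r X](phi1E aE).
set f := sect p r (cseq p 1).
set e' := texp2 3 a; set u' := fun j : int => _.
pose t : int := 3 - 2 * a%:Z.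
have pt : p%:Z = 6 * v%:Z + t by rewrite /t; lia.
have e'E y : e' y = y * (3 * y - t).
  by rewrite /e' /texp2 /t (_ : (2 * a)%:Z = 2 * a%:Z) //; ring.
have [[j0 [n0 E0]]|none] := pselect (exists j n, e' j = (2 * (p * n + r))%:Z); last first.
  rewrite (sect_gser0 u' none) => /phiI; rewrite mul0r => ->; exact: one_signed0.
pose hA (s : nat) i := p%:Z * i + (s%:Z - v%:Z).
pose hB (s : nat) i := - (p%:Z * i + (v%:Z + s%:Z)).
have [s [i0 [b0 [sp j0E]]]] : exists s i b, (2 * s < p)%N /\ j0 = if b then hA s i else hB s i.
  have jE := divz_eq (j0 + v%:Z) p%:Z; set m := ((j0 + v%:Z) %% p%:Z)%Z in jE.
  have m0 : 0 <= m by apply: modz_ge0; lia.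
  have mp : m < p%:Z by apply: ltz_pmod; lia.
  set d := (_ %/ _)%Z in jE.
  have [h|h] := ltrP (2 * m) p%:Z.
    by exists (absz m), d, true; rewrite /hA; split; lia.
  have [q qE] : exists q, p = (2 * q).+1 by exists p./2; lia.
  by exists (absz (p%:Z - m)%R), (- d - 1), false; rewrite /hB; split; lia.
have classes j n : e' j = (2 * (p * n + r))%:Z -> exists i,
    hA s i = j \/ hB s i = j.
  move=> Ej.
  have : (p%:Z %| (j - j0) * (3 * (j + j0) - t))%Z.
    apply/dvdzP; exists (2 * (n%:Z - n0%:Z)).
    have -> : (j - j0) * (3 * (j + j0) - t) = e' j - e' j0 by rewrite !e'E; ring.
    by rewrite Ej E0; lia.
  rewrite dvdzE abszM Euclid_dvdM // => /orP[]; rewrite -dvdzE => /dvdzP[d dE].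
    case: b0 j0E => j0E.
      by exists (d + i0); left; rewrite j0E /hA in dE *; lia.
    by exists (i0 - d); right; rewrite j0E /hB in dE *; lia.
  have [m dm] : exists m, d = 3 * m - 1.
    have tt : t * t = 1 by rewrite /t; case/orP: aE => /eqP ->.
    have td : t * (d + 1) = 3 * (j + j0 - 2 * v%:Z * d) by rewrite pt in dE; lia.
    exists (t * (j + j0 - 2 * v%:Z * d)).
    have : t * (t * (d + 1)) = 3 * (t * (j + j0 - 2 * v%:Z * d)) by rewrite td; ring.
    by rewrite mulrA tt; lia.
  have X : j + j0 = p%:Z * m - 2 * v%:Z.
    by rewrite dm pt in dE; rewrite pt; lia.
  case: b0 j0E => j0E.
    by exists (i0 - m); right; rewrite /hB; rewrite /hA in j0E; lia.
  by exists (i0 + m); left; rewrite /hA; rewrite /hB in j0E; lia.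
pose c := e' (hA s 0).
have c0 : 0 <= c.
  have a0 : (0 < a)%N by case/orP: aE => /eqP->.
  have a3 : (a <= 3)%N by case/orP: aE => /eqP->.
  by rewrite /c /e' texp2E.
have cA i : e' (hA s i) = p%:Z * quin p s (true, i) + c.
  rewrite /c !e'E /hA /quin /= pt; ring.
have cB i : e' (hB s i) = p%:Z * quin p s (false, i) + c.
  rewrite /c !e'E /hB /hA /quin /= pt; ring.
pose sg := odd (absz (s%:Z - v%:Z)).
have uA i : u' (hA s i) = (-1) ^+ sg * (-1) ^+ absz i by exact: signrD_absz.
have uB i : u' (hB s i) = (-1) ^+ sg * (-1) ^+ absz i.
  by rewrite /u' /hB abszN signrD_absz //; congr ((-1) ^+ nat_of_bool _ * _); rewrite /sg; lia.
have pI x y : p%:Z * x = p%:Z * y -> x = y by apply: mulfI; lia.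
(* For s = 0 the two classes coincide. *)
have [s0|s0] := posnP s.
- have i1E : exists i, e' (hA s i) = (2 * (p * n0 + r))%:Z.
    rewrite -E0 j0E; case: (b0); first by exists i0.
    by exists (- i0); congr e'; rewrite /hA /hB s0; lia.
  have [i1 E1] := i1E.
  pose e := texp2 (3 * p) p.
  have p30 : (0 < 3 * p)%N by lia. have pp3 : (p <= 3 * p)%N by lia.
  have eh i : e' (hA s i) = p%:Z * e i + c.
    rewrite cA /e /quin /texp2 /= s0 (_ : (3 * p)%:Z = 3 * p%:Z) // (_ : (2 * p)%:Z = 2 * p%:Z) //.
    ring.
  have hinj : injective (hA s) by move=> x y; rewrite /hA => xy; apply: pI; lia.
  have surj j n : e' j = (2 * (p * n + r))%:Z -> exists i, hA s i = j.
    move=> /classes[i [<-|<-]]; first by exists i.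
    by exists (- i); rewrite /hA /hB s0; lia.
  have [C ->] := sect_gser rp hinj (evenly_texp2 p30 p0 pp3) c0 eh uA surj E1.
  rewrite gser_scale jacobi_triple_product //; last by lia.
  have -> : euler (fun n => (3 * p %| n) + (n %% (3 * p) == p) + (n %% (3 * p) == 3 * p - p))%N
    = euler (fun n => (p %| n)%N : nat).
    rewrite -euler_prog3 //; apply: euler_ext => n _.
    have -> : (3 * p - 2 * p = p)%N by lia.
    have -> : (3 * p - p = 2 * p)%N by lia.
    by rewrite addnAC.
  move=> /phiI ->.
  exists sg, 1%N, (monom C * (euler (fun n => (p %| n) + (n == 1))%N * part (fun=> 1%N))).
  split=> //; last by rewrite eulerD euler1 //; ring.
  apply: nonnegM; first exact: nonneg_monom.
  rewrite euler_part; first exact: nonneg_part.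
  move=> n _; have [->|_] := eqVneq n 1%N; last by case: (p %| n)%N.
  by rewrite dvdn1; have -> : (p == 1)%N = false by apply/eqP; lia.
pose h (x : bool * int) := if x.1 then hA s x.2 else hB s x.2.
have off x y : hA s x <> hB s y.
  rewrite /hA /hB => xy; have : p%:Z * (x + y) = - (2 * s)%:Z by lia.
  have [t0|t0] := lerP 0 (x + y).
    by have := mulr_ge0 (isT : 0 <= p%:Z) t0; lia.
  have : p%:Z * (x + y) <= p%:Z * (- 1) by apply: ler_wpM2l => //; lia.
  by lia.
have hinj : injective h.
  move=> [[] x] [[] y]; rewrite /h /= => xy.
  - by congr (_, _); apply: pI; rewrite /hA in xy; lia.
  - by case: (off x y).
  - by case: (off y x).
  - by congr (_, _); apply: pI; rewrite /hB in xy; lia.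
have eh x : e' (h x) = p%:Z * quin p s x + c by case: x => [[] i]; rewrite /h /=.
have uh x : u' (h x) = (-1) ^+ sg * quinw x by case: x => [[] i]; rewrite /h /=.
have surj j n : e' j = (2 * (p * n + r))%:Z -> exists x, h x = j.
  by move=> /classes[i [<-|<-]]; [exists (true, i) | exists (false, i)].
have E1 : e' (h (b0, i0)) = (2 * (p * n0 + r))%:Z by rewrite -E0 j0E.
have [C ->] := sect_gser rp hinj (evenly_quin p0 (ltnW sp)) c0 eh uh surj E1.
rewrite gser_scale => /phiI ->.
exists sg, s, (monom C * (gser (quin p s) quinw * part (fun=> 1%N) * bin s)).
split=> //; last by ring.
by apply: nonnegM; [exact: nonneg_monom | exact: nonneg_quin_part].
Qed.

(** For p = 3 the indices of a section form a single class, and the section is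
    a theta series modulo 9. *)
Lemma sect_phi1_3 r : (r < 3)%N -> one_signed (sect 3 r (cseq 3 1)).
Proof.
move=> r3; have := sect_cseq 1 r3.
rewrite [X in _ = sect 3 r X]expr1 [X in _ = sect 3 r X](@phi1E 1) //.
set f := sect 3 r (cseq 3 1).
set e' := texp2 3 1; set u' := fun j : int => _.
have e'E y : e' y = y * (3 * y - 1) by rewrite /e' /texp2; ring.
have [[j0 [n0 E0]]|none] := pselect (exists j n, e' j = (2 * (3 * n + r))%:Z); last first.
  rewrite (sect_gser0 u' none) => /phiI; rewrite mul0r => ->; exact: one_signed0.
have [i0 [k [kE j0E]]] : exists i k, (-1 <= k <= 1) /\ j0 = 3 * i + k.
  exists ((j0 + 1) %/ 3)%Z, (((j0 + 1) %% 3)%Z - 1); lia.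
pose s := absz (3 * k + 4); pose h (i : int) := 3 * i + k.
have sE : s%:Z = 3 * k + 4 by rewrite /s; lia.
have s147 : [|| s == 1, s == 4 | s == 7]%N by lia.
have s0 : (0 < s)%N by lia. have s9 : (s < 9)%N by lia.
have c0 : 0 <= e' k by rewrite /e' texp2E.
have hinj : injective h by move=> x y; rewrite /h; lia.
have eh i : e' (h i) = 3%N%:Z * texp2 9 s i + e' k.
  by rewrite !e'E /h /texp2 PoszM sE; ring.
have uh i : u' (h i) = (-1) ^+ odd (absz k) * (-1) ^+ absz i.
  exact: (@signrD_absz 3).
have surj j n : e' j = (2 * (3 * n + r))%:Z -> exists i, h i = j.
  move=> Ej; exists ((j - k) %/ 3)%Z; rewrite /h.
  have : (j - j0) * (3 * (j + j0) - 1) = 3 * (2 * (n%:Z - n0%:Z)).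
    have -> : (j - j0) * (3 * (j + j0) - 1) = e' j - e' j0 by rewrite !e'E; ring.
    by rewrite Ej E0; lia.
  set X := (j - j0) * (j + j0) => EX.
  have EX' : 3 * X - (j - j0) = 3 * (2 * (n%:Z - n0%:Z)) by rewrite -EX /X; ring.
  lia.
have E1 : e' (h i0) = (2 * (3 * n0 + r))%:Z by rewrite -E0 j0E.
have [C ->] := sect_gser r3 hinj (@evenly_texp2 9 s isT s0 (ltnW s9)) c0 eh uh surj E1.
rewrite gser_scale (jacobi_triple_product s0 s9) => /phiI ->.
set b := fun n => _.
exists (odd (absz k)), 3%N, (monom C * (euler (fun n => b n + (n == 3))%N * part (fun=> 1%N))).
split=> //; last by rewrite eulerD euler1 //; ring.
apply: nonnegM; first exact: nonneg_monom.
rewrite euler_part; first exact: nonneg_part.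
move=> n _; rewrite /b /dvdn.
have [->|_] := eqVneq n 3%N; first by case/or3P: s147 => /eqP->.
have : (n %% 9 < 9)%N by rewrite ltn_mod.
move: (n %% 9)%N => x.
by case/or3P: s147 => /eqP->; do 9 (case: x => [//|x]).
Qed.

(** * The case t = 2 *)

Lemma qpoch_eulerM p : (0 < p)%N -> qpoch 'X^p 'X^p = eulerM p.
Proof.
move=> p0; apply/funext => n; rewrite -(@eulerM_eqm p p0 n.+1 n.+1) //.
rewrite /qpoch /qfact big_mkord -[LHS]/(ps_of_poly _ n); congr (_ n).
rewrite (big_morph _ ps_of_polyM ps_of_poly1); apply: eq_bigr => i _.
by rewrite -exprM -exprD ps_of_polyB ps_of_poly1 ps_of_polyX mulnS.
Qed.

(** The product of the factors of odd degree, (q; q^2)_oo. *)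
Definition phi_odd : ps := iprod (fun j => bin (1 + 2 * j)).

Lemma cseq2E m : cseq 2 m = phi_odd ^+ m.
Proof.
have oddE : phi_odd = euler (fun n => (n %% 2 == 1)%N : nat) := @euler_prog 2 isT 1 isT.
have phiM : phi = phi_odd * eulerM 2.
  rewrite oddE -eulerD; apply: euler_ext => n _.
  by rewrite /dvdn modn2; case: (odd n).
have := @cseq_mul 2 m isT; rewrite qpoch_eulerM // phiM exprMn => /(congr1 (fun f =>
  f * part (fun n => (2 %| n)%N : nat) ^+ m)).
by rewrite -!mulrA -exprMn eulerK expr1n !mulr1.
Qed.

(** The substitution of -q for q. *)
Definition twist f : ps := fun n => (-1) ^+ n * f n.

Lemma twistM f g : twist (f * g) = twist f * twist g.
Proof.
apply/funext => n; rewrite /twist !psmE mulr_sumr; apply: eq_bigr => i _.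
by rewrite -{1}(subnKC (leq_ord i)) exprD; ring.
Qed.

Lemma twist1 : twist 1 = 1.
Proof. by apply/funext => -[|n]; rewrite /twist ?mulr1 // ps1E mulr0. Qed.

Lemma twist_exp f m : twist (f ^+ m) = twist f ^+ m.
Proof.
elim: m => [|m IHm]; first exact: twist1.
by rewrite !exprS twistM IHm.
Qed.

Lemma twist_bin k : odd k -> twist (bin k) = 1 + monom k.
Proof.
move=> ok; apply/funext => n; rewrite /twist binE !psaE psoE ps1E /monom.
have [->|nk] := eqVneq n k; last first.
  by case: n {nk} => [|n] /=; ring.
case: k ok => // k ok.
by rewrite -signr_odd ok.
Qed.

Lemma nonneg_mul_ge f g n : nonneg f -> nonneg g -> g 0%N = 1 -> f n <= (f * g) n.
Proof.
move=> f0 g0 g1; rewrite psmE (bigD1 ord_max) //= subnn g1 mulr1 lerDl.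
by apply: sumr_ge0 => i _; apply: mulr_ge0.
Qed.

Lemma prod_coef0 I (r : seq I) (P : pred I) (F : I -> ps) :
  (forall i, P i -> F i 0%N = 1) -> (\prod_(i <- r | P i) F i) 0%N = 1.
Proof.
by move=> F1; elim/big_ind: _ => // x y x1 y1; rewrite psm0 x1 y1.
Qed.

(** Every n > 2 is a sum of distinct odd numbers: itself, or (n - 1) + 1. *)
Lemma twist_phi_odd : nonneg (twist phi_odd) /\ twist phi_odd 0%N = 1 /\
  forall n, (2 < n)%N -> 0 < twist phi_odd n.
Proof.
pose F j : ps := 1 + monom (1 + 2 * j).
have F0 j : nonneg (F j) by apply: nonnegD; [exact: nonneg1 | exact: nonneg_monom].
have F1 j : F j 0%N = 1 by [].
have E n : twist phi_odd n = (\prod_(j < n.+1) F j) n.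
  rewrite /twist /phi_odd /iprod -[LHS]/(twist _ n); congr (_ n).
  rewrite (big_morph _ twistM twist1); apply: eq_bigr => j _.
  by rewrite twist_bin //= oddM.
split; first by move=> n; rewrite E; apply: nonneg_prod.
split; first by rewrite E prod_coef0.
move=> n n2; rewrite E.
have [o|e] := boolP (odd n).
  have [j nE] : exists j, n = (1 + 2 * j)%N by exists n./2; lia.
  have jn : (j < n.+1)%N by lia.
  rewrite (bigD1 (Ordinal jn)) //=.
  apply: lt_le_trans (nonneg_mul_ge _ _ _ _).
  - by rewrite /F psaE ps1E /monom -nE eqxx; case: (n == 0%N).
  - exact: F0.
  - exact: nonneg_prod.
  - by rewrite prod_coef0.
have [j nE] : exists j, n = (1 + (1 + 2 * j))%N by exists (n./2.-1); lia.
have jn : (j < n.+1)%N by lia.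
rewrite (bigD1 ord0) // (bigD1 (Ordinal jn)) /=; last by rewrite -val_eqE /=; lia.
rewrite mulrA; apply: lt_le_trans (nonneg_mul_ge _ _ _ _).
- have -> : F (@ord0 n) * F j = 1 + monom 1 + monom (1 + 2 * j) + monom n.
    have -> : monom n = monom 1 * monom (1 + 2 * j) by rewrite -monomD -nE.
    by rewrite /F muln0 addn0; ring.
  rewrite !psaE ps1E /monom eqxx.
  by case: (n == 0%N); case: (n == 1%N); case: (n == _).
- exact: nonnegM.
- exact: nonneg_prod.
- by rewrite prod_coef0.
Qed.

Lemma cseq2_signs m : (0 < m)%N -> (forall n, 0 <= (-1) ^+ n * cseq 2 m n) /\
  forall n, (2 < n)%N -> cseq 2 m n != 0.
Proof.
move=> m0; have [O0 [O1 Opos]] := twist_phi_odd.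
have E n : (-1) ^+ n * cseq 2 m n = (twist phi_odd ^+ m) n.
  by rewrite -twist_exp -cseq2E.
have powm k : nonneg (twist phi_odd ^+ k) /\ (twist phi_odd ^+ k) 0%N = 1.
  split; first exact: nonneg_exp.
  by elim: k => // k IHk; rewrite exprS psm0 O1 IHk.
split=> [n|n n2]; first by rewrite E; case: (powm m).
apply/eqP => z; have := E n; rewrite z mulr0 => z'.
case: m m0 z' {E z} => // m _; have [Pm Pm0] := powm m.
have := nonneg_mul_ge n O0 Pm Pm0; rewrite -exprS => le z'.
by have := lt_le_trans (Opos n n2) le; rewrite -z' ltxx.
Qed.

Theorem theorem1p7 :
  (forall m : nat, (0 < m)%N ->
     UPS (cseq 2 m) /\
     exists T : nat, least_period_of_sign (cseq 2 m) T /\ (2 %| T)%N) /\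
  (forall p m : nat, prime p -> m = 1%N \/ m = 3%N ->
     UPS (cseq p m) /\
     exists T : nat, least_period_of_sign (cseq p m) T /\ (p %| T)%N).
Proof.
have case2 m : (0 < m)%N -> UPS (cseq 2 m) /\
    exists T : nat, least_period_of_sign (cseq 2 m) T /\ (2 %| T)%N.
  move=> m0; have [sgn nz] := cseq2_signs m0; have [c0 c1] := @cseq_01 2 m isT.
  apply: sign_periods_of_sections => //; try by rewrite ?c0 ?c1; lia.
  move=> r r2; exists (odd r), 2%N; split=> // n.
    by have := sgn (2 * n + r)%N; rewrite -signr_odd oddD oddM.
  by move=> _; apply: nz; lia.
split=> // p m pp m13; have p1 := prime_gt1 pp.
have m0 : (0 < m)%N by case: m13 => ->.
have [->|p2] := eqVneq p 2%N; first exact: case2.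
have op : odd p by have [] := even_prime pp; move/eqP: p2.
have [c0 c1] := @cseq_01 p m p1.
apply: sign_periods_of_sections => //; try by rewrite ?c0 ?c1; lia.
move=> r rp; apply: (@one_signed_signs (sect p r (cseq p m))).
case: m13 => ->; last exact: sect_phi3.
have [pE|p3] := eqVneq p 3%N; first by move: rp; rewrite pE; exact: sect_phi1_3.
have p3' : (3 < p)%N by lia.
have n3 : ~~ (3 %| p)%N by rewrite dvdn_prime2 // eq_sym.
have [h|h] : (p %% 6 = 1 \/ p %% 6 = 5)%N by lia.
  by apply: (@sect_phi1 p r 1 (p %/ 6)) => //; lia.
by apply: (@sect_phi1 p r 2 (p %/ 6).+1) => //; lia.
Qed.
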